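(* For every positive integer $n$, the maps $\sigma^{(n)}:\mathcal{H}^{(n)}\to\mathcal{H}^{(n)}$ (defined by path removals) and $\overline{\sigma}^{(n)}:\mathcal{H}^{(n)}\to\mathcal{H}^{(n)}$ (defined by path additions) are mutually inverse bijections.
   Context: Partitions. A partition has weakly decreasing nonnegative integer parts; $\ell(\lambda)$ is the number of positive parts, $|\lambda|$ the sum of the parts, and $\mu\subseteq\lambda$ means $\mu_i\le\lambda_i$ for all $i$. Partitions of length $\le n$ are padded with zeros to $n$ parts. Hives. An integer $n$-hive is a family of integers $a_{ij}$ ($0\le i\le j\le n$), $a_{00}=0$ (vertex labels of a triangular array of side $n$), with edge labels $\alpha_{ij}=a_{ij}-a_{i,j-1}$ ($0\le i<j\le n$), $\beta_{ij}=a_{ij}-a_{i-1,j}$, $\gamma_{ij}=a_{ij}-a_{i-1,j-1}$ ($1\le i\le j\le n$), such that for all $1\le i<j\le n$ the gradients $R_{ij}=\alpha_{i-1,j-1}-\alpha_{ij}$, $U_{ij}=\alpha_{ij}-\alpha_{i-1,j}=\beta_{ij}-\beta_{i,j-1}$, $L_{ij}=\beta_{i,j-1}-\beta_{i+1,j}$ are $\ge0$. Edge labels satisfy the triangle conditions $\gamma_{ij}=\alpha_{i-1,j}+\beta_{ij}$ and $\gamma_{ij}=\beta_{i,j-1}+\alpha_{ij}$ ($i<j$) and determine the hive. $U_{ij}$ is the $(i,j)$ upright rhombus gradient; the $j$-th diagonal comprises the upright rhombi $(i,j)$, $i=1,\dots,j-1$, and the triangle with bottom edge $\gamma_{jj}$.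 An LR hive is an integer hive with all edge labels $\ge0$. $\mathcal{H}^{(n)}(\lambda,\mu,\nu)$ is the set of LR $n$-hives with lower boundary $\gamma_{kk}=\lambda_k$, left boundary $\alpha_{0k}=\mu_k$, right boundary $\beta_{kn}=\nu_k$ ($1\le k\le n$). $\mathcal{H}^{(n)}$ is the union of all $\mathcal{H}^{(n)}(\lambda,\mu,\nu)$ with $\ell(\lambda)\le n$, $\mu,\nu\subseteq\lambda$, $|\lambda|=|\mu|+|\nu|$. Level $k$ of the left boundary is the edge $\alpha_{0k}$. The empty hive $H^{(0)}$ is the $0$-hive (a single vertex). Path removals on $H\in\mathcal{H}^{(r)}(\lambda,\mu,\nu)$ (changing edge labels): (i) $\chi_r$ (if $\nu_r>0$): decrease $\gamma_{rr}$ and $\beta_{rr}$ by 1. (ii) $\phi_r$ (if $U_{ir}>0$ for some $i<r$, equivalently $\lambda_r-\mu_r-\nu_r>0$): put $i_{r+1}=r$ and for $d=r,r-1,\dots$ let $i_d=\max\{i<i_{d+1}:U_{id}>0\}$ as long as this set is nonempty; let $k$ be the first $d$ for which it is empty, and put $i_k=0$ (so $1\le k<r$). Decrease by 1 the labels $\gamma_{rr}$, $\alpha_{id}$ for $i_d\le i<i_{d+1}$, and $\gamma_{id}$ for $i_d<i<i_{d+1}$ ($k\le d\le r$), and increase by 1 the labels $\beta_{i_d,d-1}$ ($k<d\le r$). The path is said to terminate at level $k$. (iii) $\omega_r$ (if $\mu_r>0$): decrease by 1 all $\alpha_{ir}$ ($0\le i<r$) and $\gamma_{ir}$ ($1\le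 i\le r$). Full $r$-hive path removal: $\theta_r=\omega_r^{\mu_r}\phi_r^{\lambda_r-\mu_r-\nu_r}\chi_r^{\nu_r}$ (rightmost acts first) if $\ell(\lambda)=r$, and the identity if $\ell(\lambda)<r$. It makes the $r$-th diagonal empty (boundary labels $\gamma_{rr},\alpha_{0r},\beta_{rr}$ and gradients $U_{ir}$ all zero). $\kappa_r$ deletes an empty $r$-th diagonal, turning the $r$-hive into an $(r-1)$-hive. The map $\sigma^{(n)}$. For $H\in\mathcal{H}^{(n)}(\lambda,\mu,\nu)$ set $H^{(n)}=H$ and $H^{(r-1)}=\kappa_r\theta_rH^{(r)}$ for $r=n,\dots,1$. For $1\le k<r\le n$ let $V_{kr}$ be the number of the $\phi_r$-paths removed in applying $\theta_r$ to $H^{(r)}$ that terminate at level $k$. Then $\sigma^{(n)}H=K\in\mathcal{H}^{(n)}(\lambda,\nu,\mu)$ is the hive with left boundary $\nu$, right boundary $\mu$ and upright rhombus gradients $V_{kr}$; that is, $\alpha_{ij}=\nu_j+\sum_{k\le i}V_{kj}$, $\beta_{ij}=\mu_i-\sum_{m>j}V_{im}$, $\gamma_{ij}=\alpha_{i-1,j}+\beta_{ij}$. Path additions. These act on integer-labelled triangular arrays of side $r$ satisfying the triangle conditions and with all $U_{ij}\ge0$, changing edge labels. $\overline{\chi}_r$: increase $\beta_{rr}$ and $\gamma_{rr}$ by 1. $\overline{\omega}_r$: increase by 1 all $\alpha_{ir}$ ($0\le i<r$) and all $\gamma_{ir}$ ($1\le i\le r$). $\overline{\phi}_k$ ($1\le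 k<r$): put $s_k=1$; for $k\le d<r$ let $i_d=\min\{i:s_d\le i<d,\ U_{id}>0\}$ if this set is nonempty and $i_d=d$ otherwise, and put $s_{d+1}=i_d+1$; put $i_r=r$. Increase by 1 the labels $\alpha_{id}$ for $s_d-1\le i\le i_d-1$ and $\gamma_{id}$ for $s_d\le i\le i_d-1$ ($k\le d\le r$) and the label $\gamma_{rr}$; decrease by 1 the labels $\beta_{i_d,d}$ ($k\le d<r$). The operator $\kappa_r^{-1}$ adds to an array of side $r-1$ an $r$-th diagonal with $\alpha_{ir}=0$ ($0\le i<r$), $\beta_{ir}=\gamma_{ir}=\beta_{i,r-1}$ ($1\le i<r$), $\beta_{rr}=\gamma_{rr}=0$. The map $\overline{\sigma}^{(n)}$. For $K\in\mathcal{H}^{(n)}(\lambda,\nu,\mu)$ with upright rhombus gradients $V_{ij}$ put $\overline{\theta}_r=\overline{\chi}_r^{\,\nu_r}\overline{\phi}_1^{\,V_{1r}}\overline{\phi}_2^{\,V_{2r}}\cdots\overline{\phi}_{r-1}^{\,V_{r-1,r}}\overline{\omega}_r^{\,\mu_r-V_{r,n}-\cdots-V_{r,r+1}}$ (rightmost acts first) and $\overline{\sigma}^{(n)}K=\overline{\theta}_n\kappa_n^{-1}\cdots\overline{\theta}_1\kappa_1^{-1}H^{(0)}\in\mathcal{H}^{(n)}(\lambda,\mu,\nu)$. *)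

(* Defs.v *)
From HB Require Import structures.
From mathcomp Require Import all_boot all_order all_algebra.

Set Implicit Arguments.
Unset Strict Implicit.
Unset Printing Implicit Defensive.

Import Order.TTheory GRing.Theory Num.Theory.
Local Open Scope ring_scope.

(* Partitions are weakly decreasing sequences, possibly with trailing zeros;
   all the notions below are insensitive to the latter. *)
Definition is_part (s : seq nat) : bool := sorted geq s.
Definition part (s : seq nat) (k : nat) : nat := nth 0%N s k.-1.  (* k >= 1 *)
Definition plen (s : seq nat) : nat := count (ltn 0) s.
Definition pincl (s t : seq nat) : Prop :=
  forall k, (0 < k)%N -> (part s k <= part t k)%N.

(* Vertex labellings of the triangular array of side n: the labels are a_ij
   for 0 <= i <= j <= n. *)
Definition vertex (n : nat) := {v : 'I_n.+1 * 'I_n.+1 | (v.1 <= v.2)%N}.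
Definition tri (n : nat) := {ffun vertex n -> int}.

(* a_ij; meaningful only for i <= j <= n *)
Definition vlab n (H : tri n) (i j : nat) : int :=
  oapp H 0 (insub (inord i : 'I_n.+1, inord j : 'I_n.+1)).

(* Edge labels of a triangular array whose side r is kept track of separately:
   al i j is meaningful for 0 <= i < j <= r, be i j and ga i j for
   1 <= i <= j <= r. *)
Record elabels := ELabels {
  al : nat -> nat -> int;
  be : nat -> nat -> int;
  ga : nat -> nat -> int }.

Definition edges n (H : tri n) : elabels := {|
  al := fun i j => vlab H i j - vlab H i j.-1;
  be := fun i j => vlab H i j - vlab H i.-1 j;
  ga := fun i j => vlab H i j - vlab H i.-1 j.-1 |}.

(* The vertex labelling with a_00 = 0 recovered from edge labels satisfying the
   triangle conditions, by summing from (0,0) to (0,j) and then to (i,j). *)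
Definition of_edges n (E : elabels) : tri n :=
  [ffun v : vertex n =>
     \sum_(1 <= k < (val v).2.+1) al E 0 k
     + \sum_(1 <= k < (val v).1.+1) be E k (val v).2].

(* The gradients, for 1 <= i < j. *)
Definition Rg (E : elabels) i j : int := al E i.-1 j.-1 - al E i j.
Definition Ug (E : elabels) i j : int := al E i j - al E i.-1 j.
Definition Lg (E : elabels) i j : int := be E i j.-1 - be E i.+1 j.

Definition is_hive n (H : tri n) : Prop :=
  vlab H 0 0 = 0 /\
  (forall i j, (1 <= i < j)%N -> (j <= n)%N ->
     [/\ 0 <= Rg (edges H) i j, 0 <= Ug (edges H) i j & 0 <= Lg (edges H) i j]).

Definition is_LR_hive n (H : tri n) : Prop :=
  [/\ is_hive H,
      forall i j, (i < j <= n)%N -> 0 <= al (edges H) i j &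
      forall i j, (1 <= i <= j)%N -> (j <= n)%N ->
        0 <= be (edges H) i j /\ 0 <= ga (edges H) i j].

(* H^(n)(lam, mu, nu) *)
Definition LR_hives n (lam mu nu : seq nat) (H : tri n) : Prop :=
  is_LR_hive H /\
  (forall k, (1 <= k <= n)%N ->
     [/\ ga (edges H) k k = (part lam k)%:Z,
         al (edges H) 0 k = (part mu k)%:Z &
         be (edges H) k n = (part nu k)%:Z]).

(* H^(n) *)
Definition all_LR_hives n (H : tri n) : Prop :=
  exists lam mu nu : seq nat,
    [/\ [/\ is_part lam, is_part mu & is_part nu],
        (plen lam <= n)%N,
        pincl mu lam /\ pincl nu lam,
        sumn lam = (sumn mu + sumn nu)%N &
        LR_hives lam mu nu H].

(* [shift c P f] adds c to the labels f i j such that P i j. *)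
Definition shift (c : int) (P : nat -> nat -> bool) (f : nat -> nat -> int) :=
  fun i j => if P i j then f i j + c else f i j.

Definition chi (r : nat) (E : elabels) : elabels := {|
  al := al E;
  be := shift (-1) (fun i j => (i == r) && (j == r)) (be E);
  ga := shift (-1) (fun i j => (i == r) && (j == r)) (ga E) |}.

Definition omega (r : nat) (E : elabels) : elabels := {|
  al := shift (-1) (fun i j => (i < r)%N && (j == r)) (al E);
  be := be E;
  ga := shift (-1) (fun i j => (1 <= i <= r)%N && (j == r)) (ga E) |}.

(* [rem_idx_rec r E e] is i_d for d = r.+1 - e.  The maximum of the empty set
   is 0, which gives i_k = 0 at the terminating level k, and then i_d = 0 for
   all d < k. *)
Fixpoint rem_idx_rec (r : nat) (E : elabels) (e : nat) : nat :=
  match e with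
  | 0 => r
  | e'.+1 =>
      \max_(i < rem_idx_rec r E e' | (0 < i)%N && (0 < Ug E i (r - e')%N)) i
  end.
Definition rem_idx (r : nat) (E : elabels) (d : nat) : nat :=
  rem_idx_rec r E (r.+1 - d).

(* The terminating level: the first d, going down from r, such that i_d = 0 *)
Definition rem_level (r : nat) (E : elabels) : nat :=
  \max_(d < r.+1 | rem_idx r E d == 0%N) d.

Definition phi (r : nat) (E : elabels) : elabels :=
  let k := rem_level r E in
  let i_ := rem_idx r E in {|
  al := shift (-1)
          (fun i d => (k <= d <= r)%N && (i_ d <= i < i_ d.+1)%N) (al E);
  be := shift 1 (fun i j => (k <= j < r)%N && (i == i_ j.+1)) (be E);
  ga := shift (-1)
          (fun i d => (k <= d <= r)%N && (i_ d < i < i_ d.+1)%N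
                      || (i == r) && (d == r)) (ga E) |}.

Definition lower_boundary (r : nat) (E : elabels) : seq nat :=
  [seq `|ga E k k|%N | k <- iota 1 r].

(* Exponents are nonnegative on LR hives, so that absz is only a cast there. *)
Definition nchi (r : nat) (E : elabels) : nat :=
  if plen (lower_boundary r E) == r then `|be E r r|%N else 0%N.
Definition nphi (r : nat) (E : elabels) : nat :=
  if plen (lower_boundary r E) == r
  then `|(ga E r r - al E 0 r - be E r r)%R|%N else 0%N.
Definition nomega (r : nat) (E : elabels) : nat :=
  if plen (lower_boundary r E) == r then `|al E 0 r|%N else 0%N.

(* The array obtained from E, in the course of applying theta_r, once all the
   chi_r-paths and the first t phi_r-paths have been removed *)
Definition theta_stage (r : nat) (E : elabels) (t : nat) : elabels :=
  iter t (phi r) (iter (nchi r E) (chi r) E).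

Definition theta (r : nat) (E : elabels) : elabels :=
  iter (nomega r E) (omega r) (theta_stage r E (nphi r E)).

(* The number of phi_r-paths removed in applying theta_r to E that terminate
   at level k *)
Definition nterm (r : nat) (E : elabels) (k : nat) : nat :=
  \sum_(t < nphi r E) (rem_level r (theta_stage r E t) == k).

Definition kappa (r : nat) (E : elabels) : elabels := {|
  al := fun i j => if (j < r)%N then al E i j else 0;
  be := fun i j => if (j < r)%N then be E i j else 0;
  ga := fun i j => if (j < r)%N then ga E i j else 0 |}.

(* H^(n - d) *)
Fixpoint rem_chain n (H : tri n) (d : nat) : elabels :=
  match d with
  | 0 => edges H
  | d'.+1 => let r := (n - d')%N in kappa r (theta r (rem_chain H d'))
  end.

(* V_kr, for 1 <= k < r <= n *)
Definition Vrem n (H : tri n) (k r : nat) : nat :=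
  nterm r (rem_chain H (n - r)%N) k.

Definition sigma_edges n (H : tri n) : elabels :=
  let a i j := be (edges H) j n + (\sum_(1 <= k < i.+1) Vrem H k j)%N%:Z in
  let b i j := al (edges H) 0 i - (\sum_(j.+1 <= m < n.+1) Vrem H i m)%N%:Z in
  {| al := a; be := b; ga := fun i j => a i.-1 j + b i j |}.

Definition sigma n (H : tri n) : tri n := of_edges n (sigma_edges H).

Definition chi_add (r : nat) (E : elabels) : elabels := {|
  al := al E;
  be := shift 1 (fun i j => (i == r) && (j == r)) (be E);
  ga := shift 1 (fun i j => (i == r) && (j == r)) (ga E) |}.

Definition omega_add (r : nat) (E : elabels) : elabels := {|
  al := shift 1 (fun i j => (i < r)%N && (j == r)) (al E);
  be := be E;
  ga := shift 1 (fun i j => (1 <= i <= r)%N && (j == r)) (ga E) |}.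

(* min {i | s <= i < d, U_id > 0}, or d if this set is empty *)
Definition first_pos (E : elabels) (s d : nat) : nat :=
  head d [seq i <- iota s (d - s) | 0 < Ug E i d].

(* [add_start_rec E k e] is s_d for d = k + e. *)
Fixpoint add_start_rec (E : elabels) (k e : nat) : nat :=
  match e with
  | 0 => 1
  | e'.+1 => (first_pos E (add_start_rec E k e') (k + e')).+1
  end.
Definition add_start (E : elabels) (k d : nat) : nat :=
  add_start_rec E k (d - k).
Definition add_idx (r : nat) (E : elabels) (k d : nat) : nat :=
  if d == r then r else first_pos E (add_start E k d) d.

(* phibar_k acting on arrays of side r *)
Definition phi_add (r k : nat) (E : elabels) : elabels :=
  let s := add_start E k in
  let i_ := add_idx r E k in {|
  al := shift 1 (fun i d => (k <= d <= r)%N && ((s d).-1 <= i < i_ d)%N) (al E);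
  be := shift (-1) (fun i d => (k <= d < r)%N && (i == i_ d)) (be E);
  ga := shift 1 (fun i d => (k <= d <= r)%N && (s d <= i < i_ d)%N
                            || (i == r) && (d == r)) (ga E) |}.

Definition kappa_inv (r : nat) (E : elabels) : elabels := {|
  al := fun i j => if j == r then 0 else al E i j;
  be := fun i j => if j == r then (if (i < r)%N then be E i r.-1 else 0)
                   else be E i j;
  ga := fun i j => if j == r then (if (i < r)%N then be E i r.-1 else 0)
                   else ga E i j |}.

(* thetabar_r for K in H^(n)(lam, nu, mu): here nu_r is al 0 r, mu_r is be r n
   and V_ir is the upright gradient of K. *)
Definition theta_add n (K : tri n) (r : nat) (E : elabels) : elabels :=
  let V i j := Ug (edges K) i j in
  let nomega :=
    `|(be (edges K) r n - \sum_(r.+1 <= m < n.+1) V r m)%R|%N in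
  let nchi := `|al (edges K) 0 r|%N in
  iter nchi (chi_add r)
    (foldr (fun k F => iter `|V k r|%N (phi_add r k) F)
       (iter nomega (omega_add r) E) (iota 1 r.-1)).

(* The 0-hive has no edges: all labels are out of range. *)
Definition empty_edges : elabels :=
  {| al := fun _ _ => 0; be := fun _ _ => 0; ga := fun _ _ => 0 |}.

Fixpoint add_chain n (K : tri n) (r : nat) : elabels :=
  match r with
  | 0 => empty_edges
  | r'.+1 => theta_add K r'.+1 (kappa_inv r'.+1 (add_chain K r'))
  end.

Definition sigma_add n (K : tri n) : tri n := of_edges n (add_chain K n).

(* Main.v *)
Require Import Defs.
From mathcomp Require Import all_boot all_order all_algebra.
From mathcomp Require Import zify.

Set Implicit Arguments.
Unset Strict Implicit.
Unset Printing Implicit Defensive.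

Import Order.TTheory GRing.Theory Num.Theory.
Local Open Scope ring_scope.

(** The labels of a triangular array are read as a tableau: row d holds
[al E 0 d] letters 0, [Ug E i d] letters i for 0 < i < d, and [be E d d]
letters d, so that [al E i d] counts the letters at most i in row d and
[be E i d] the letters i in the rows up to d.  In these terms the inequalities
[R] and [L] say that columns are strict and that the reading word is a lattice
word, and the path removal [phi r] is a reverse row insertion: the largest
letter below r leaves row r and moves up, each row d that it meets exchanging
the arriving letter for the largest smaller one, until a 0 is expelled, at the
terminating level.

Everything rests on one count.  For the paths removed by [theta r], let N x d
be the number of those that take a letter greater than x out of row d
([passes]).  Successive paths pass weakly to the left of one another
([rem_idx_phi_le]), which gives the tropical octahedron recurrence
([path_count_step], [passes_step])
  N x d = min (N (x+1) d + Ug E (x+1) d) (N (x+1) (d+1)):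
the letters x+1 of row d that leave are limited by their supply and by the
arrivals from row d+1.  The labels after [theta r] are the old ones corrected
by differences of N ([al_theta], [be_theta]) and the numbers of paths by
terminating level are the differences of N 0 ([nterm_passes]).  Each inequality
then follows by induction from the recurrence and linear arithmetic: the
truncated array is an LR array again ([lr_theta]), the [L] inequalities of
[sigma H] say that the letters 0 before and after [theta r] interlace
([inner_interlace]), and its [R] inequalities compare the counts N of two
consecutive removals ([passes_shift]).  Hence [sigma] preserves LR hives.

Row insertion undoes reverse row insertion, so adding a path from the level at
which the last one terminated restores the array ([phi_addK]).  The levels
weakly increase along the removal ([level_mono]), so [theta_add] adds the paths
in exactly the reverse order ([phi_add_all]), and [sigma_add] is a left inverse
of [sigma] on LR hives ([sigmaK]).  The remaining two claims come for free:
[sigma] preserves the last vertex label, only finitely many LR hives share that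
label, and an injection of a finite set into itself is onto ([sigma_surj]). *)

(** * A single removal path *)

Section RemovalPath.
Variables (r : nat) (E : elabels).
Let idx := rem_idx r E.

Lemma rem_idx_start : idx r.+1 = r.
Proof. by rewrite /idx /rem_idx subnn. Qed.

Lemma rem_idx_rec_eq d : (d <= r)%N ->
  idx d = \max_(i < idx d.+1 | (0 < i)%N && (0 < Ug E i d)) i.
Proof. by move=> ledr; rewrite /idx /rem_idx subSS subSn //= subKn. Qed.

(** The maximum in the definition of the path, tested letter by letter: row d
sends out a letter greater than x exactly when a letter greater than x+1
arrives and row d either sends out one greater than x+1 as well or owns a
letter x+1. *)
Lemma rem_idx_step d x : (d <= r)%N ->
  (x < idx d)%N =
  (x.+1 < idx d.+1)%N && ((x.+1 < idx d)%N || (0 < Ug E x.+1 d)).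
Proof.
move=> ledr; rewrite (rem_idx_rec_eq ledr); set m := idx d.+1.
apply/idP/idP => [ltxm|/andP[ltxm /orP[/ltnW //|Ux]]]; last first.
  refine (leq_trans _ (@leq_bigmax_cond _
    (fun i : 'I_m => (0 < i)%N && (0 < Ug E i d))
    (fun i : 'I_m => nat_of_ord i) (Ordinal ltxm) Ux)); exact: leqnn.
have [i /andP[i_gt0 Ui] def_i]: {i : 'I_m | (0 < i)%N && (0 < Ug E i d) &
    \max_(i < m | (0 < i)%N && (0 < Ug E i d)) i = i}.
  apply: eq_bigmax_cond; apply/card_gt0P.
  have [i Pi|no] := pickP [pred i : 'I_m | (0 < i)%N && (0 < Ug E i d)].
    by exists i.
  by rewrite big_pred0 // in ltxm.
rewrite def_i in ltxm *; rewrite (leq_ltn_trans ltxm (ltn_ord i)) /=.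
by move: ltxm; rewrite leq_eqVlt => /orP[/eqP->|->]; rewrite ?Ui ?orbT.
Qed.

Lemma rem_idx_ltS d x : (d <= r)%N -> (x < idx d)%N -> (x.+1 < idx d.+1)%N.
Proof. by move=> ledr; rewrite rem_idx_step // => /andP[]. Qed.

Lemma rem_idx_pred d : (d <= r.+1)%N -> (idx d <= d.-1)%N.
Proof.
move=> ledr; rewrite -(subKn ledr); elim: (r.+1 - d)%N => [|e IHe].
  by rewrite subn0 rem_idx_start.
have [lter|leer] := ltnP e r.+1; last first.
  move: IHe; have ->: (r.+1 - e = 0)%N by lia.
  by have ->: (r.+1 - e.+1 = 0)%N by lia.
set d' := (r.+1 - e.+1)%N in IHe *.
have ledr' : (d' <= r)%N by rewrite /d'; lia.
have eqd : (r.+1 - e = d'.+1)%N by rewrite /d'; lia.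
rewrite eqd in IHe.
case E0: (idx d') => [//|x].
have := rem_idx_ltS ledr' (x := x); rewrite -/d' E0 ltnSn => /(_ isT).
by move: IHe => /=; lia.
Qed.

Lemma rem_idx0 d : (d <= 1)%N -> idx d = 0%N.
Proof.
move=> led1; have := @rem_idx_pred d; rewrite (leq_trans led1) // => /(_ isT).
by lia.
Qed.

Lemma rem_idx_gt0_mono d e : (d <= e <= r.+1)%N -> (0 < idx d)%N -> (0 < idx e)%N.
Proof.
move=> /andP[lede leer] d_gt0; elim: e lede leer => [|e IHe].
  by rewrite leqn0 => /eqP d0; rewrite d0 in d_gt0.
rewrite leq_eqVlt => /predU1P[<- //|lede] leer.
exact: ltnW (rem_idx_ltS leer (IHe lede (ltnW leer))).
Qed.

(** The rows crossed by the path without reaching a 0 are those below the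
terminating level. *)
Lemma rem_level_lt d : (d <= r)%N -> (rem_level r E < d)%N = (0 < idx d)%N.
Proof.
move=> ledr; apply/idP/idP; last first.
  move=> d_gt0; rewrite ltnNge; apply/negP => ledk.
  have [k /eqP k0 defk] : {k : 'I_r.+1 | rem_idx r E k == 0%N & rem_level r E = k}.
    apply: eq_bigmax_cond; apply/card_gt0P; exists ord0.
    by change (rem_idx r E 0 == 0%N); apply/eqP; exact: (@rem_idx0 0).
  rewrite defk in ledk; have := rem_idx_gt0_mono (d := d) (e := k).
  by rewrite ledk -ltnS ltnS (ltnW (ltn_ord k)) d_gt0 /idx k0 => /(_ isT isT).
rewrite lt0n; apply: contraTN => /eqP d0; rewrite -leqNgt.
have ltdr : (d < r.+1)%N by [].
refine (leq_trans _ (@leq_bigmax_cond _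
  (fun d : 'I_r.+1 => rem_idx r E d == 0%N)
  (fun i => nat_of_ord i) (Ordinal ltdr) _)); rewrite /= -/idx ?d0 //.
Qed.

Lemma rem_level_eq k : (k < r)%N ->
  (rem_level r E == k) = (0 < idx k.+1)%N && (idx k == 0%N).
Proof.
move=> ltkr; rewrite -rem_level_lt // [_ == 0%N]eqn0Ngt -rem_level_lt ?(ltnW ltkr) //.
by rewrite ltnS -leqNgt eqn_leq.
Qed.

(** Above the terminating level all indices are 0, so that the path edges are
cut out by the indices alone; this makes the effect of [phi] additive in the
comparisons [x < rem_idx r E d] that [path_count] adds up. *)
Lemma al_phi i d : (d <= r)%N ->
  al (phi r E) i d = al E i d - (idx d <= i < idx d.+1)%N%:Z.
Proof.
move=> ledr; rewrite /= /shift -/idx ledr andbT.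
have [ltdk|ledk] := ltnP d (rem_level r E) => /=.
  have /eqP -> : idx d.+1 == 0%N.
    rewrite eqn0Ngt; have [ltdr|] := ltnP d r; first by rewrite -rem_level_lt -?ltnNge.
    move=> lerd; have: (rem_level r E <= r)%N.
      by apply/bigmax_leqP => i0 _; rewrite -ltnS.
    by lia.
  by rewrite ltn0 andbF subr0.
by case: ifP => _; rewrite ?subr0.
Qed.

Lemma be_phi i d : (0 < i)%N -> (d < r)%N ->
  be (phi r E) i d = be E i d + (i == idx d.+1)%:Z.
Proof.
move=> i_gt0 ltdr; rewrite /= /shift -/idx ltdr andbT.
have [ltdk|ledk] := ltnP d (rem_level r E) => /=.
  have /eqP -> : idx d.+1 == 0%N by rewrite eqn0Ngt -rem_level_lt -?ltnNge.
  by rewrite eqn0Ngt i_gt0 addr0.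
by case: ifP => _; rewrite ?addr0.
Qed.

Lemma be_phi_last i : be (phi r E) i r = be E i r.
Proof. by rewrite /= /shift ltnn andbF. Qed.

Lemma ga_phi_diag d : (d < r)%N -> ga (phi r E) d d = ga E d d.
Proof.
move=> ltdr; rewrite /= /shift -/idx; case: ifP => // /orP[]; last by lia.
by have := @rem_idx_pred d.+1; rewrite /= ltnS (ltnW ltdr); lia.
Qed.

Lemma Ug_phi i d : (0 < i)%N -> (d <= r)%N ->
  Ug (phi r E) i d = Ug E i d - (i == idx d)%:Z + (i == idx d.+1)%:Z.
Proof.
case: i => // i _ ledr; rewrite /Ug !al_phi //=.
by have := rem_idx_ltS (x := (idx d).-1) ledr; lia.
Qed.

Lemma Ug_rem_idx_gt0 d : (d <= r)%N -> (0 < idx d)%N -> 0 < Ug E (idx d) d.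
Proof.
move=> ledr d_gt0; have := rem_idx_step (idx d).-1 ledr; rewrite prednK //.
by rewrite leqnn ltnn /= => /esym/andP[].
Qed.

Lemma Ug_between d i : (d <= r)%N -> (idx d < i < idx d.+1)%N -> Ug E i d <= 0.
Proof.
case: i => // i ledr /andP[lti ltiS]; rewrite leNgt; apply/negP => U_gt0.
have := rem_idx_step i ledr; rewrite ltiS U_gt0 orbT; move: lti; lia.
Qed.

Lemma Ug_phi_ge0 i d : (0 < i)%N -> (d <= r)%N -> 0 <= Ug E i d ->
  0 <= Ug (phi r E) i d.
Proof.
move=> i_gt0 ledr U_ge0; rewrite Ug_phi //.
by have := Ug_rem_idx_gt0 ledr; case: (i =P idx d) => [<-|]; lia.
Qed.

End RemovalPath.

(** Two successive paths do not cross: at every row the second one takes out a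
letter at most that of the first.  The letter that row d gained from the first
path is at least every letter that arrives with the second, hence never among
the candidates of the second. *)
Lemma rem_idx_phi_le r E d : (d <= r.+1)%N ->
  (rem_idx r (phi r E) d <= rem_idx r E d)%N.
Proof.
move=> ledr; rewrite -(subKn ledr); elim: (r.+1 - d)%N => [|e IHe].
  by rewrite subn0 !rem_idx_start.
have [lter|leer] := ltnP e r.+1; last first.
  by have ->: (r.+1 - e.+1 = r.+1 - e)%N by lia.
set d' := (r.+1 - e.+1)%N.
have ledr' : (d' <= r)%N by rewrite /d'; lia.
have eqd : (r.+1 - e = d'.+1)%N by rewrite /d'; lia.
rewrite eqd in IHe.
suff sub x : (x < rem_idx r (phi r E) d' -> x < rem_idx r E d')%N.
  by case: (rem_idx r (phi r E) d') sub => // y /(_ y (ltnSn y)).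
have [k] := ubnP (r - x)%N; elim: k x => // k IHk x ltk.
rewrite rem_idx_step // => /andP[ltxS /orP[ltx|]].
  apply: ltnW; apply: IHk => //.
  have := rem_idx_pred (phi r E) (leqW ledr').
  by move: ltx ltk; lia.
rewrite Ug_phi // (rem_idx_step E x ledr') => U_gt0.
by rewrite (leq_trans ltxS IHe); lia.
Qed.

(** * Adding back the last removed path *)

(** Only the in-range labels [al] and [be] matter: the path additions read no
others, and the vertex labels are recovered from them. *)
Definition agree r (E F : elabels) : Prop :=
  (forall i j, (i < j <= r)%N -> al E i j = al F i j) /\
  (forall i j, (0 < i <= j)%N -> (j <= r)%N -> be E i j = be F i j).

Definition rows_weak r (E : elabels) : Prop :=
  forall i d, (0 < i < d)%N -> (d <= r)%N -> 0 <= Ug E i d.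

Lemma first_pos_eq F s d j : (s <= j <= d)%N ->
    (forall i, (s <= i < j)%N -> Ug F i d <= 0) ->
    ((j < d)%N -> 0 < Ug F j d) ->
  first_pos F s d = j.
Proof.
move=> /andP[lesj lejd] U_le0 U_gt0; rewrite /first_pos.
have -> : (d - s = (j - s) + (d - j))%N by lia.
rewrite iotaD filter_cat subnKC //.
rewrite (@eq_in_filter _ _ pred0) => [|i]; last first.
  by rewrite mem_iota subnKC // => /U_le0; rewrite ltNge => ->.
rewrite filter_pred0 /=; move: U_gt0; rewrite -subn_gt0.
case def_m: (d - j)%N => [|m] /=; last by move=> ->.
by move=> _; move/eqP: def_m; lia.
Qed.

(** Row insertion undoes reverse row insertion.  In row d the letter that came
in is again the smallest one greater than the letter that went out, since the
removal passed over empty places between the two. *)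
Lemma phi_addK r E F :
    rows_weak r E -> (rem_level r E < r)%N -> agree r F (phi r E) ->
  agree r (phi_add r (rem_level r E) F) E.
Proof.
move=> weakE; set k := rem_level r E; set idx := rem_idx r E => ltkr [alF beF].
have UF i d : (0 < i < d)%N -> (d <= r)%N -> Ug F i d = Ug (phi r E) i d.
  by case: i => // i /= ltid ledr; rewrite /Ug !alF // ?ledr ?andbT //= ltnW.
have idx_gt0 d : (k <= d < r)%N -> (0 < idx d.+1)%N.
  by case/andP=> lekd ltdr; rewrite -rem_level_lt.
have idxk : idx k = 0%N.
  by apply/eqP; rewrite eqn0Ngt -rem_level_lt ?ltnn // ltnW.
have first d : (k <= d < r)%N -> first_pos F (idx d).+1 d = idx d.+1.
  move=> /andP[lekd ltdr]; have ledr := ltnW ltdr.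
  have ltSd := rem_idx_pred E (d := d.+1) (leqW ltdr).
  have pos := idx_gt0 d; rewrite lekd ltdr in pos; have {}pos := pos isT.
  have ltid : (idx d < idx d.+1)%N.
    rewrite ltnNge; apply/negP => le; have := @rem_idx_ltS r E d (idx d).-1 ledr.
    by move: pos le; rewrite -/idx; lia.
  apply: first_pos_eq => [|i /andP[lti ltiS]|ltd]; first by rewrite ltid.
    rewrite UF //; last by move: ltSd; rewrite -/idx /=; lia.
    rewrite Ug_phi //; last by lia.
    have := @Ug_between r E d i ledr; rewrite -/idx lti ltiS => /(_ isT).
    by lia.
  rewrite UF ?pos // Ug_phi // -/idx.
  by have := weakE (idx d.+1) d; rewrite pos ltd => /(_ isT ledr); lia.
have start d : (k <= d <= r)%N -> add_start F k d = (idx d).+1.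
  move=> /andP[lekd ledr]; rewrite /add_start -(subnKC lekd).
  rewrite addKn; have: (k + (d - k) <= r)%N by rewrite subnKC.
  elim: (d - k)%N => [|e IHe] ler; first by rewrite addn0 idxk.
  rewrite addnS in ler *; rewrite /= IHe ?first // ?leq_addr //.
  exact: ltnW.
have add_idxE d : (k <= d <= r)%N -> add_idx r F k d = idx d.+1.
  move=> /andP[lekd ledr]; rewrite /add_idx; case: eqP => [->|/eqP nedr].
    by rewrite /idx rem_idx_start.
  have ltdr : (d < r)%N by rewrite ltn_neqAle nedr.
  by rewrite start ?first ?lekd.
split=> [i d /andP[ltid ledr]|i d /andP[i_gt0 leid] ledr] /=; rewrite /shift.
  rewrite alF ?ltid //= /shift -/k -/idx ledr andbT.
  case: (leqP k d) => //= lekd; rewrite start ?add_idxE ?lekd ?ledr //=.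
  by case: (_ && _); rewrite ?subrK.
rewrite beF ?i_gt0 //= /shift -/k -/idx.
case: (leqP k d) => //= lekd; case: ltnP => //= ltdr.
by rewrite add_idxE ?lekd ?ledr //=; case: (_ == _); rewrite ?addrK.
Qed.

(** * Counting the paths through a row *)

(** For [d = r.+1] the index is r by convention, so that below r every path is
counted, as if r arrived in row r from an imaginary row below. *)
Definition path_count r E t x d : nat :=
  \sum_(s < t) (x < rem_idx r (iter s (phi r) E) d).

Section PathCount.
Variables (r : nat) (E : elabels).
Let idx t := rem_idx r (iter t (phi r) E).
Let N := path_count r E.

Lemma path_countS t x d : N t.+1 x d = (N t x d + (x < idx t d))%N.
Proof. by rewrite /N /path_count big_ord_recr. Qed.

Lemma path_count0 x d : N 0 x d = 0%N.
Proof. by rewrite /N /path_count big_ord0. Qed.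

Lemma path_count_start t x : (x < r)%N -> N t x r.+1 = t.
Proof.
move=> ltxr; elim: t => [|t IHt]; rewrite ?path_count0 // path_countS IHt.
by rewrite /idx rem_idx_start ltxr addn1.
Qed.

Lemma path_count_anti t x d : (N t x.+1 d <= N t x d)%N.
Proof. by apply: leq_sum => s _; case: ltnP => // /ltnW ->. Qed.

Lemma path_count_out t x d : (d <= r.+1)%N -> (d.-1 <= x)%N -> N t x d = 0%N.
Proof.
move=> ledr ledx; rewrite /N /path_count big1 // => s _.
by rewrite ltnNge (leq_trans _ ledx) // rem_idx_pred.
Qed.

Lemma path_count_up t x d : (d <= r)%N -> (N t x d <= N t x.+1 d.+1)%N.
Proof.
move=> ledr; apply: leq_sum => s _; case: ltnP => // ltx.
by rewrite (rem_idx_ltS ledr ltx).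
Qed.

Lemma al_iter_phi t i d : (d <= r)%N ->
  al (iter t (phi r) E) i d = al E i d - (N t i d.+1)%:Z + (N t i d)%:Z.
Proof.
move=> ledr; elim: t => [|t IHt]; first by rewrite !path_count0 subr0 addr0.
rewrite iterS al_phi // IHt !path_countS -/(idx t).
have := rem_idx_ltS (E := iter t (phi r) E) (x := i) ledr; rewrite -/(idx t).
by case: ltnP; case: ltnP; lia.
Qed.

Lemma be_iter_phi t i d : (d < r)%N ->
  be (iter t (phi r) E) i.+1 d
    = be E i.+1 d + (N t i d.+1)%:Z - (N t i.+1 d.+1)%:Z.
Proof.
move=> ltdr; elim: t => [|t IHt]; first by rewrite !path_count0 subr0 addr0.
by rewrite iterS be_phi // IHt !path_countS -/(idx t); lia.
Qed.

Lemma be_iter_phi_last t i : be (iter t (phi r) E) i r = be E i r.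
Proof. by elim: t => // t IHt; rewrite iterS be_phi_last. Qed.

Lemma ga_iter_phi_diag t d : (d < r)%N -> ga (iter t (phi r) E) d d = ga E d d.
Proof. by move=> ltdr; elim: t => // t IHt; rewrite iterS ga_phi_diag. Qed.

Lemma rem_idx_iter_anti s t d : (d <= r.+1)%N -> (s <= t)%N ->
  (idx t d <= idx s d)%N.
Proof.
move=> ledr /subnK <-; elim: (t - s)%N => // m IHm.
by apply: leq_trans IHm; apply: rem_idx_phi_le.
Qed.

(** As the outgoing letters weakly decrease with time, a large outgoing letter
now was large at all earlier times. *)
Lemma path_count_all t x d : (d <= r.+1)%N -> (x < idx t d)%N -> N t x d = t.
Proof.
move=> ledr ltx; rewrite /N /path_count (eq_bigr (fun=> 1%N)).
  by rewrite sum_nat_const card_ord muln1.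
move=> s _; have := rem_idx_iter_anti (s := s) (t := t) ledr (ltnW (ltn_ord s)).
by move=> /(leq_trans ltx); rewrite /idx => ->.
Qed.

(** The octahedron recurrence.  Once the second argument of the minimum grows
while [path_count] at x+1 does not, the path arrives in row d with a letter
greater than x+1 and passes to a letter at most x+1; by [path_count_all] no
letter x+1 has arrived in row d so far, so that the current supply of x+1 is
the initial one less those already sent out. *)
Lemma path_count_step t x d : (d <= r)%N -> 0 <= Ug E x.+1 d ->
  (N t x d)%:Z = Num.min ((N t x.+1 d)%:Z + Ug E x.+1 d) (N t x.+1 d.+1)%:Z.
Proof.
move=> ledr U_ge0; elim: t => [|t IHt]; first by rewrite !path_count0; lia.
rewrite !path_countS.
have := rem_idx_step (iter t (phi r) E) x ledr; rewrite -/(idx t).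
have [ltq|leq] /= := ltnP x.+1 (idx t d.+1); last first.
  move=> ->; have := @rem_idx_ltS _ (iter t (phi r) E) _ x.+1 ledr.
  by rewrite -/(idx t); case: ltnP => /= _; lia.
have NqS := path_count_all (d := d.+1) ledr ltq.
have Nq := path_count_all (d := d.+1) ledr (ltnW ltq).
have: Ug (iter t (phi r) E) x.+1 d =
    Ug E x.+1 d - ((N t x d)%:Z - (N t x.+1 d)%:Z).
  by rewrite /Ug !al_iter_phi //= NqS Nq; lia.
by move=> -> ->; case: ltnP => /= _; lia.
Qed.

Lemma rows_weak_iter_phi t : rows_weak r E -> rows_weak r (iter t (phi r) E).
Proof.
move=> weakE; elim: t => // t IHt i d /andP[i_gt0 ltid] ledr.
by rewrite iterS; apply: Ug_phi_ge0 => //; apply: IHt; rewrite // i_gt0.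
Qed.

End PathCount.

(** * LR arrays and the full removal *)

(** The conditions on edge labels that characterise LR hives of side r.  Every
gradient is indexed by [i < j < r] for the rhombus (i+1, j+1); nonnegativity of
all edge labels follows from that of two corner labels. *)
Record lr_array r (E : elabels) : Prop := LRArray {
  lr_triangle : forall i j, (i < j < r)%N ->
    be E i.+1 j.+1 - be E i.+1 j = al E i.+1 j.+1 - al E i j.+1;
  lr_upright : forall i j, (i < j < r)%N -> al E i j.+1 <= al E i.+1 j.+1;
  lr_right : forall i j, (i < j < r)%N -> al E i.+1 j.+1 <= al E i j;
  lr_left : forall i j, (i < j < r)%N -> be E i.+2 j.+1 <= be E i.+1 j;
  lr_al_ge0 : (0 < r)%N -> 0 <= al E 0 r;
  lr_be_ge0 : (0 < r)%N -> 0 <= be E r r;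
  lr_lower : forall j, (j < r)%N ->
    ga E j.+1 j.+1 = al E j j.+1 + be E j.+1 j.+1 }.

Lemma lr_rows_weak r E : lr_array r E -> rows_weak r E.
Proof.
move=> lrE [|i] [|d] //= ltid ltdr; rewrite /Ug subr_ge0.
by apply: (lr_upright lrE); apply/andP.
Qed.

Lemma lr_al_mono r E i j d : lr_array r E -> (i <= j < d)%N -> (d <= r)%N ->
  al E i d <= al E j d.
Proof.
move=> lrE; elim: j => [|j IHj] /andP[leij ltjd] ledr.
  by move: leij; rewrite leqn0 => /eqP ->.
move: leij; rewrite leq_eqVlt => /predU1P[-> // | leij].
apply: le_trans (IHj _ ledr) _; first by rewrite -ltnS leij ltnW.
by case: d {IHj} ltjd ledr => // d ltjd ledr; apply: (lr_upright lrE); rewrite ledr andbT.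
Qed.

Lemma lr_lower_anti r E j : lr_array r E -> (j.+1 < r)%N ->
  ga E j.+2 j.+2 <= ga E j.+1 j.+1.
Proof.
move=> lrE ltjr; rewrite !(lr_lower lrE) ?(ltnW ltjr) //.
apply: lerD; first by apply: (lr_right lrE); rewrite ltnSn.
by apply: (lr_left lrE); rewrite ltnSn.
Qed.

(** If the lower boundary has fewer than r positive parts then row r is empty,
and the three right-hand sides vanish as well. *)
Lemma lr_exponents r E : lr_array r E -> (0 < r)%N ->
  [/\ nchi r E = `|be E r r|%N, nphi r E = `|(al E r.-1 r - al E 0 r)%R|%N
    & nomega r E = `|al E 0 r|%N].
Proof.
case: r => // r lrE _; rewrite /nchi /nphi /nomega.
have -> : ga E r.+1 r.+1 - al E 0 r.+1 - be E r.+1 r.+1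
          = al E r r.+1 - al E 0 r.+1 by rewrite (lr_lower lrE) //; lia.
case: ifP => // plen_r; rewrite /=.
have ga_le k : (k <= r)%N -> ga E r.+1 r.+1 <= ga E k.+1 k.+1.
  move=> lekr; have: (r < r.+1)%N by []; rewrite -{1 3 4}(subnKC lekr).
  elim: (r - k)%N => [|m IHm]; rewrite ?addn0 // addnS => ltm.
  by apply: le_trans (IHm (ltnW ltm)); apply: (lr_lower_anti lrE).
have al0 := lr_al_ge0 lrE isT; have be0 := lr_be_ge0 lrE isT.
have le_al : al E 0 r.+1 <= al E r r.+1 by apply: (lr_al_mono lrE) => /=.
have lower := lr_lower lrE (ltnSn r).
suff: ga E r.+1 r.+1 <= 0 by split; lia.
have: ~~ all (ltn 0) (lower_boundary r.+1 E).
  rewrite all_count; move: plen_r; rewrite /plen /lower_boundary => /negbT.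
  by rewrite size_map size_iota.
rewrite all_map => /allPn[[|k]]; rewrite mem_iota //= => ltk.
by have := ga_le k; lia.
Qed.

(** The array on which the [phi]-paths start. *)
Definition after_chi r E := iter (nchi r E) (chi r) E.
Definition passes r E x d : nat :=
  path_count r (after_chi r E) (nphi r E) x d.

Lemma al_iter_chi r t E : al (iter t (chi r) E) = al E.
Proof. by elim: t => // t IHt; rewrite iterS. Qed.

Lemma be_iter_chi r t E i d : (i < r)%N || (d < r)%N ->
  be (iter t (chi r) E) i d = be E i d.
Proof.
move=> out; elim: t => // t IHt; rewrite iterS /= /shift IHt.
by case: ifP => //; lia.
Qed.

Lemma be_iter_chi_last r t E : be (iter t (chi r) E) r r = be E r r - t%:Z.
Proof.
by elim: t => [|t IHt]; rewrite ?subr0 // iterS /= /shift eqxx /= IHt; lia.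
Qed.

Lemma ga_iter_chi_diag r t E d : (d < r)%N ->
  ga (iter t (chi r) E) d d = ga E d d.
Proof.
move=> ltdr; elim: t => // t IHt; rewrite iterS /= /shift IHt.
by case: ifP => //; lia.
Qed.

Lemma al_iter_omega r t E i d :
  al (iter t (omega r) E) i d
  = if (i < r)%N && (d == r) then al E i d - t%:Z else al E i d.
Proof.
elim: t => [|t IHt]; first by rewrite subr0 if_same.
by rewrite iterS /= /shift IHt; case: (_ && _) => //; lia.
Qed.

Lemma be_iter_omega r t E : be (iter t (omega r) E) = be E.
Proof. by elim: t => // t IHt; rewrite iterS. Qed.

Lemma ga_iter_omega_diag r t E d : (d < r)%N ->
  ga (iter t (omega r) E) d d = ga E d d.
Proof.
move=> ltdr; elim: t => // t IHt; rewrite iterS /= /shift IHt.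
by case: ifP => //; lia.
Qed.

Section FullRemoval.
Variables (r : nat) (E : elabels).
Hypotheses (r_gt0 : (0 < r)%N) (lrE : lr_array r E).
Let P := after_chi r E.
Let N := passes r E.

Lemma nphi_eq : (nphi r E)%:Z = al E r.-1 r - al E 0 r.
Proof.
have [_ -> _] := lr_exponents lrE r_gt0.
have := @lr_al_mono r E 0 r.-1 r lrE; rewrite leq0n prednK // leqnn.
by move=> /(_ isT isT); lia.
Qed.

(** Row r sends out its letters from the largest to the smallest, hence first
the [al E r.-1 r - al E x r] letters between x+1 and r-1. *)
Lemma path_count_last_row t x : (x < r)%N ->
  (path_count r P t x r)%:Z = Num.min (al E r.-1 r - al E x r) t%:Z.
Proof.
have [m] := ubnP (r.-1 - x)%N; elim: m x => // m IHm x ltm ltxr.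
have [ltSxr|lerSx] := ltnP x.+1 r; last first.
  have -> : x = r.-1 by lia.
  by rewrite path_count_out //; lia.
have U_ge0 : 0 <= Ug P x.+1 r.
  by rewrite /Ug /P al_iter_chi; apply: (lr_rows_weak lrE).
rewrite path_count_step // path_count_start // IHm //; last by lia.
by move: U_ge0; rewrite /Ug /P al_iter_chi /=; lia.
Qed.

Lemma passes_last_row x : (x < r)%N -> (N x r)%:Z = al E r.-1 r - al E x r.
Proof.
move=> ltxr; rewrite /N /passes path_count_last_row // nphi_eq.
have := @lr_al_mono r E 0 x r lrE; rewrite ltxr leqnn => /(_ isT isT).
by lia.
Qed.

Lemma passes_step x d : (x.+1 < d <= r)%N ->
  (N x d)%:Z
  = Num.min ((N x.+1 d)%:Z + (al E x.+1 d - al E x d)) (N x.+1 d.+1)%:Z.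
Proof.
move=> /andP[ltxd ledr]; rewrite /N /passes path_count_step //.
  by rewrite /Ug /after_chi al_iter_chi.
by rewrite /Ug /after_chi al_iter_chi; apply: (lr_rows_weak lrE).
Qed.

Lemma passes_out x d : (d <= r.+1)%N -> (d.-1 <= x)%N -> N x d = 0%N.
Proof. exact: path_count_out. Qed.

Lemma passes_anti x d : (N x.+1 d <= N x d)%N.
Proof. exact: path_count_anti. Qed.

Lemma passes_up x d : (d <= r)%N -> (N x d <= N x.+1 d.+1)%N.
Proof. exact: path_count_up. Qed.

(** At each of the [nphi r E] steps row r still owns a positive letter, so that
the path leaves it, and no 0 is expelled from row r itself. *)
Lemma rem_level_stage t : (t < nphi r E)%N ->
  (0 < rem_level r (theta_stage r E t) < r)%N.
Proof.
move=> ltt; rewrite rem_level_lt //; apply/andP; split.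
  have := rem_level_lt (theta_stage r E t) (d := 1) r_gt0.
  rewrite (@rem_idx0 _ _ 1) //; lia.
have := path_count_last_row t.+1 r_gt0; have := path_count_last_row t r_gt0.
rewrite -nphi_eq.
rewrite path_countS /theta_stage -/(after_chi r E) -/P.
by case: (0 < _)%N => //; lia.
Qed.

(** A path terminates at level k when it crosses row k+1 with a positive letter
and expels a 0 from row k. *)
Lemma nterm_passes k : (k < r)%N -> (nterm r E k + N 0 k)%N = N 0 k.+1.
Proof.
move=> ltkr; rewrite /nterm /N /passes /path_count -big_split /=.
apply: eq_bigr => t _; rewrite rem_level_eq // -/(theta_stage r E t).
have := @rem_idx_ltS r (theta_stage r E t) k 0 (ltnW ltkr).
by case: (rem_idx _ _ k) => [|i] /=; [rewrite andbT addn0 | move=> /(_ isT) /ltnW ->].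
Qed.

Lemma al_theta x d : (d < r)%N ->
  al (theta r E) x d = al E x d - (N x d.+1)%:Z + (N x d)%:Z.
Proof.
move=> ltdr; rewrite /theta /theta_stage al_iter_omega al_iter_phi ?(ltnW ltdr) //.
by rewrite (ltn_eqF ltdr) andbF al_iter_chi.
Qed.

Lemma be_theta x d : (d < r)%N ->
  be (theta r E) x.+1 d = be E x.+1 d + (N x d.+1)%:Z - (N x.+1 d.+1)%:Z.
Proof.
move=> ltdr; rewrite /theta /theta_stage be_iter_omega be_iter_phi //.
by rewrite be_iter_chi // ltdr orbT.
Qed.

Lemma ga_theta d : (d < r)%N -> ga (theta r E) d d = ga E d d.
Proof.
move=> ltdr; rewrite /theta /theta_stage ga_iter_omega_diag //.
by rewrite ga_iter_phi_diag // ga_iter_chi_diag.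
Qed.

Lemma al_theta_last x : (x < r)%N -> al (theta r E) x r = 0.
Proof.
move=> ltxr; rewrite /theta /theta_stage al_iter_omega ltxr eqxx /=.
rewrite al_iter_phi // al_iter_chi path_count_start // nphi_eq.
rewrite -/(after_chi r E) -/(passes r E x r) passes_last_row //.
have [_ _ ->] := lr_exponents lrE r_gt0; have := lr_al_ge0 lrE r_gt0.
lia.
Qed.

Lemma be_theta_last : be (theta r E) r r = 0.
Proof.
rewrite /theta /theta_stage be_iter_omega be_iter_phi_last be_iter_chi_last.
by have [-> _ _] := lr_exponents lrE r_gt0; have := lr_be_ge0 lrE r_gt0; lia.
Qed.

Lemma be_theta_right x : (x < r)%N -> be (theta r E) x r = be E x r.
Proof.
move=> ltxr; rewrite /theta /theta_stage be_iter_omega be_iter_phi_last.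
by rewrite be_iter_chi // ltxr.
Qed.

Lemma be_theta_stay x : (x.+1 < r)%N ->
  be (theta r E) x.+1 r = be (theta r E) x.+1 r.-1.
Proof.
move=> ltxr; rewrite be_theta_right // be_theta ?prednK //.
rewrite !passes_last_row // ?(ltnW ltxr) //.
by case: r ltxr lrE => // r' ltxr lrE'; have /= := lr_triangle lrE' (i := x) (j := r');
  rewrite -ltnS ltxr ltnSn => /(_ isT); lia.
Qed.

(** The inequality compares the array before and after the removal.  For x = 0
it says that the numbers of letters 0 interlace.  Downward induction on x: both
values allowed for [N x d] by the recurrence reduce to the inequality for x+1 or
to [lr_right] of the original array. *)
Lemma inner_interlace x d : (x < d < r)%N ->
  al E x d.+1 <= al (theta r E) x d.
Proof.
have [m] := ubnP (d - x)%N; elim: m x => // m IHm x ltm /andP[ltxd ltdr].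
rewrite al_theta //; have R := lr_right lrE (i := x) (j := d).
rewrite ltxd ltdr in R; have {}R := R isT.
have up := @passes_step x d.+1; rewrite !ltnS ltxd ltdr in up; have {}up := up isT.
have [ltxd'|ledx] := ltnP x.+1 d; last first.
  rewrite [N x d]passes_out //; [|by lia|by lia].
  by rewrite [N x.+1 d.+1]passes_out in up => //; lia.
have := IHm x.+1; rewrite ltxd' ltdr al_theta // => /(_ _ isT) IH.
have {}IH := IH ltac:(lia).
have := @passes_step x d; rewrite ltxd' (ltnW ltdr) => /(_ isT); lia.
Qed.

(** Each inequality of the new array follows from those of the old one and from
one or two instances of the recurrence for the counts N. *)
Lemma lr_theta : lr_array r.-1 (kappa r (theta r E)).
Proof.
have lt_pred j : (j < r.-1)%N -> (j.+1 < r)%N by lia.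
split=> [i j|i j|i j|i j|lt0|lt0|j] /=.
- move=> /andP[ltij /lt_pred ltjr]; rewrite ltjr (ltnW ltjr).
  rewrite !be_theta ?al_theta ?(ltnW ltjr) //.
  have := lr_triangle lrE (i := i) (j := j); rewrite ltij (ltnW ltjr) => /(_ isT).
  lia.
- move=> /andP[ltij /lt_pred ltjr]; rewrite ltjr !al_theta //.
  have := @passes_step i j.+1; rewrite !ltnS ltij (ltnW ltjr) => /(_ isT).
  by have := passes_anti i j.+2; have := passes_anti i j.+1; lia.
- move=> /andP[ltij /lt_pred ltjr]; rewrite ltjr (ltnW ltjr) !al_theta ?(ltnW ltjr) //.
  have := @passes_step i j.+1; rewrite !ltnS ltij (ltnW ltjr) => /(_ isT).
  have := lr_right lrE (i := i) (j := j); rewrite ltij (ltnW ltjr) => /(_ isT).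
  have [ltij'|leji] := ltnP i.+1 j; last first.
    by rewrite [N i j]passes_out ?[N i.+1 j.+1]passes_out //; lia.
  have := @passes_step i j; rewrite ltij' (ltnW (ltnW ltjr)) => /(_ isT).
  have := @inner_interlace i.+1 j; rewrite ltij' (ltnW ltjr) => /(_ isT).
  by rewrite al_theta ?(ltnW ltjr) //; lia.
- move=> /andP[ltij /lt_pred ltjr]; rewrite ltjr (ltnW ltjr) !be_theta ?(ltnW ltjr) //.
  have := lr_left lrE (i := i) (j := j); rewrite ltij (ltnW ltjr) => /(_ isT).
  have := lr_left lrE (i := i) (j := j.+1); rewrite ltnS (ltnW ltij) ltjr => /(_ isT).
  have := lr_triangle lrE (i := i) (j := j); rewrite ltij (ltnW ltjr) => /(_ isT).
  have := lr_triangle lrE (i := i.+1) (j := j.+1); rewrite !ltnS ltij ltjr => /(_ isT).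
  have := @passes_step i.+1 j.+2; rewrite !ltnS ltij ltjr => /(_ isT).
  have := @passes_up i.+1 j.+1 (ltnW ltjr).
  by have := @passes_step i j.+1; rewrite !ltnS ltij (ltnW ltjr) => /(_ isT); lia.
- have := @inner_interlace 0 r.-1; rewrite lt0 prednK // leqnn => /(_ isT).
  by have := lr_al_ge0 lrE r_gt0; lia.
- rewrite prednK // leqnn.
  have := @be_theta r.-2 r.-1; rewrite !prednK // leqnn => /(_ isT) ->.
  have := passes_anti r.-2 r; have := lr_be_ge0 lrE r_gt0; rewrite prednK //.
  have := lr_left lrE (i := r.-2) (j := r.-1); rewrite !prednK // !leqnn => /(_ isT).
  lia.
- move=> /lt_pred ltjr; rewrite ltjr ga_theta // (lr_lower lrE) ?(ltnW ltjr) //.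
  rewrite al_theta // be_theta //.
  by rewrite [N j j.+1]passes_out ?[N j.+1 j.+2]passes_out //; lia.
Qed.

End FullRemoval.

(** * Comparing consecutive full removals *)

Section ConsecutiveRemovals.
Variables (s : nat) (E : elabels).
Hypotheses (s_gt0 : (0 < s)%N) (lrE : lr_array s.+1 E).
Let E' := kappa s.+1 (theta s.+1 E).

(** For x = 0 this is the gradient [R] of [sigma H]: counting the [chi]-paths as
well, the paths of row s+1 that leave row d+1 are at most the paths of row s
that leave row d.  Induction from large x, through the recurrences of both
removals; the base is the lattice condition between rows s and s+1, and row s,
where the recurrence of the second removal starts, is read off from
[passes_last_row]. *)
Lemma passes_shift x d : (x < d <= s)%N ->
  be E s.+1 s.+1 + (passes s.+1 E x d.+1)%:Z
  <= be E' s s + (passes s E' x d)%:Z.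
Proof.
have lrE' : lr_array s E' := lr_theta (ltn0Sn s) lrE.
have alE' i j : (j <= s)%N -> al E' i j =
    al E i j - (passes s.+1 E i j.+1)%:Z + (passes s.+1 E i j)%:Z.
  by move=> lejs; rewrite /E' /= ltnS lejs al_theta.
have [m] := ubnP (s - x)%N; elim: m x d => // m IHm x d ltm /andP[ltxd leds].
have step := @passes_step s.+1 E lrE x d.+1; rewrite !ltnS ltxd leds in step.
have {}step := step isT.
have [ltxd'|ledx] := ltnP x.+1 d.
  have step0 := @passes_step s.+1 E lrE x d.
  rewrite ltxd' (leqW leds) in step0; have {}step0 := step0 isT.
  have IH : be E s.+1 s.+1 + (passes s.+1 E x.+1 d.+1)%:Z
      <= be E' s s + (passes s E' x.+1 d)%:Z by apply: IHm; lia.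
  have [ltds|] := ltnP d s.
    have IHS : be E s.+1 s.+1 + (passes s.+1 E x.+1 d.+2)%:Z
        <= be E' s s + (passes s E' x.+1 d.+1)%:Z by apply: IHm; lia.
    have := @passes_step s E' lrE' x d; rewrite ltxd' leds => /(_ isT).
    by rewrite !alE' //; lia.
  move=> lesd; have defd : d = s by apply/eqP; rewrite eqn_leq leds.
  subst d; rewrite [(passes s E' x s)%:Z]passes_last_row //.
  move: IH; rewrite [(passes s E' x.+1 s)%:Z]passes_last_row //.
  by rewrite !alE' //; lia.
have defd : d = x.+1 by lia.
subst d; rewrite (@passes_out s) //; last exact: leqW.
have [ltds|lesd] := ltnP x.+1 s.
  have := IHm x.+1 x.+2; rewrite (@passes_out s) // => IH.
  by have := IH ltac:(lia) ltac:(lia); lia.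
have defs : s = x.+1 by lia.
have := @be_theta s.+1 E x s (ltnSn s); rewrite /E' /= ltnSn -defs => ->.
rewrite (@passes_out s.+1 E s s.+1) //.
have := lr_left lrE (i := x) (j := s); rewrite -defs ltnSn leqnn => /(_ isT).
lia.
Qed.

End ConsecutiveRemovals.

(** * Undoing a full removal *)

Lemma agree_iter r f g (undo : forall E F, agree r F (f E) -> agree r (g F) E) :
  forall t E F, agree r F (iter t f E) -> agree r (iter t g F) E.
Proof.
move=> t E; elim: t => // t IHt F agF.
by rewrite iterSr; apply: IHt; apply: undo.
Qed.

Lemma chi_addK r E F : agree r F (chi r E) -> agree r (chi_add r F) E.
Proof.
case=> alF beF; split=> i j ltij; first by rewrite /= alF.
by move=> lejr; rewrite /= /shift beF //= /shift; case: (_ && _); rewrite ?subrK.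
Qed.

Lemma omega_addK r E F : agree r F (omega r E) -> agree r (omega_add r F) E.
Proof.
case=> alF beF; split=> i j ltij; last by move=> lejr; rewrite /= beF.
by rewrite /= /shift alF //= /shift; case: (_ && _); rewrite ?subrK.
Qed.

(** An r-th diagonal emptied by [theta r] carries no information: its edges
[be] repeat those of the preceding diagonal. *)
Lemma kappa_invK r E F : (0 < r)%N -> lr_array r E ->
    agree r.-1 F (kappa r (theta r E)) ->
  agree r (kappa_inv r F) (theta r E).
Proof.
move=> r_gt0 lrE [alF beF]; split=> i j.
  move=> /andP[ltij lejr] /=; case: eqP => [defj|/eqP nejr].
    by rewrite defj al_theta_last // -defj.
  have ltjr : (j < r)%N by rewrite ltn_neqAle nejr.
  by rewrite alF /= ?ltjr // ltij -ltnS prednK.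
move=> /andP[i_gt0 leij] lejr /=; case: eqP => [defj|/eqP nejr].
  rewrite defj; case: ifP => ltir; last first.
    by have -> : i = r; [lia | rewrite be_theta_last].
  rewrite beF ?i_gt0 //=; last by lia.
  rewrite prednK // leqnn -(prednK i_gt0) be_theta_stay //; lia.
have ltjr : (j < r)%N by rewrite ltn_neqAle nejr.
by rewrite beF /= ?ltjr ?i_gt0 // -ltnS prednK.
Qed.

Section UndoPaths.
Variables (r : nat) (E : elabels).
Hypotheses (r_gt0 : (0 < r)%N) (lrE : lr_array r E).
Let T := nphi r E.
Let level t := rem_level r (theta_stage r E t).

(** By [rem_idx_phi_le] a later path runs out of positive letters in the same
row or in a lower one. *)
Lemma level_mono s t : (s <= t < T)%N -> (level s <= level t)%N.
Proof.
move=> /andP[lest lttT]; rewrite leqNgt; apply/negP => lt_level.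
have /andP[_ /ltnW ler] := rem_level_stage r_gt0 lrE (leq_ltn_trans lest lttT).
have := lt_level; rewrite rem_level_lt //.
have := rem_idx_iter_anti (after_chi r E) (leqW ler) lest.
move=> /[swap] /leq_trans /[apply]; rewrite -/(theta_stage r E s).
by rewrite -rem_level_lt // ltnn.
Qed.

(** As the levels weakly increase, the paths that terminate above level k are
the first [paths_above k] ones. *)
Definition paths_above k : nat := \sum_(t < T) (level t < k)%N.

Lemma paths_aboveS k : paths_above k.+1 = (nterm r E k + paths_above k)%N.
Proof.
rewrite /nterm /paths_above -big_split; apply: eq_bigr => t _ /=.
by rewrite -/(level t) ltnS leq_eqVlt; case: ltngtP.
Qed.

Lemma paths_above0 k : (k <= 1)%N -> paths_above k = 0%N.
Proof.
move=> lek1; rewrite /paths_above big1 // => t _.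
have /andP[] := rem_level_stage r_gt0 lrE (ltn_ord t).
by rewrite -/(level t); lia.
Qed.

Lemma paths_above_all : paths_above r = T.
Proof.
rewrite /paths_above (eq_bigr (fun=> 1%N)) ?sum_nat_const ?card_ord ?muln1 //.
by move=> t _; have /andP[_ ->] := rem_level_stage r_gt0 lrE (ltn_ord t).
Qed.

Lemma ltn_paths_above t k : (t < T)%N -> (t < paths_above k)%N = (level t < k)%N.
Proof.
move=> lttT; rewrite /paths_above.
have -> : (\sum_(s < T) (level s < k))%N = (\sum_(0 <= s < T) (level s < k))%N.
  by rewrite big_mkord.
have split_at j : (j <= T)%N -> (\sum_(0 <= s < T) (level s < k)
    = \sum_(0 <= s < j) (level s < k) + \sum_(j <= s < T) (level s < k))%N.
  by move=> lejT; rewrite (big_cat_nat (n := j)).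
have le_size a b : (\sum_(a <= s < b) (level s < k) <= b - a)%N.
  rewrite -[(b - a)%N]muln1 -sum_nat_const_nat.
  by apply: leq_sum => s _; case: (_ < _)%N.
case: (ltnP (level t) k) => [ltk|lek].
  rewrite (split_at t.+1) // (eq_big_nat _ _ (F2 := fun=> 1%N)); last first.
    move=> s /andP[_ lest]; rewrite (leq_ltn_trans _ ltk) //.
    by apply: level_mono; rewrite lttT andbT.
  by rewrite sum_nat_const_nat subn0 muln1 leq_addr.
apply/negbTE; rewrite -leqNgt (split_at t) ?(ltnW lttT) //.
have -> : (\sum_(t <= s < T) (level s < k) = 0)%N.
  rewrite big_nat big1 // => s /andP[lets ltsT]; rewrite ltnNge (leq_trans lek) //.
  by apply: level_mono; rewrite lets.
by rewrite addn0; have := le_size 0%N t; rewrite subn0.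
Qed.

Lemma stage_rows_weak t : rows_weak r (theta_stage r E t).
Proof.
apply: rows_weak_iter_phi => i d lt_id ledr; rewrite /Ug /after_chi al_iter_chi.
exact: lr_rows_weak lrE i d lt_id ledr.
Qed.

Lemma phi_add_paths k F : (0 < k < r)%N ->
    agree r F (theta_stage r E (paths_above k.+1)) ->
  agree r (iter (nterm r E k) (phi_add r k) F) (theta_stage r E (paths_above k)).
Proof.
move=> /andP[k_gt0 ltkr]; rewrite paths_aboveS.
have le_T : (nterm r E k + paths_above k <= T)%N.
  rewrite -paths_aboveS -[T]card_ord -sum1_card.
  by apply: leq_sum => t _; case: (_ < _)%N.
have: (nterm r E k <= nterm r E k)%N by [].
move: {1 3 4}(nterm r E k) => j; elim: j F => // j IHj F ltj agF.
rewrite iterSr; apply: IHj; first exact: ltnW.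
set t := (j + paths_above k)%N.
have lttT : (t < T)%N by rewrite /t; lia.
have -> : k = level t.
  apply/eqP; rewrite eqn_leq leqNgt -ltn_paths_above // -leqNgt leq_addl /=.
  by rewrite -ltnS -ltn_paths_above // paths_aboveS /t; lia.
apply: phi_addK agF; first exact: stage_rows_weak.
by have /andP[] := rem_level_stage r_gt0 lrE lttT.
Qed.

(** The exponents are a parameter since [theta_add] reads them off as gradients
of the other hive. *)
Lemma phi_add_all (V : nat -> nat) F :
    (forall k, (0 < k < r)%N -> V k = nterm r E k) ->
    agree r F (theta_stage r E T) ->
  agree r (foldr (fun k F => iter (V k) (phi_add r k) F) F (iota 1 r.-1))
        (after_chi r E).
Proof.
move=> eqV agF; have -> : after_chi r E = theta_stage r E (paths_above 1).
  by rewrite paths_above0.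
have: (0 < 1)%N by []; have: (1 + r.-1 = r)%N by rewrite add1n prednK.
elim: r.-1 {1 3 4 5}1%N => [|m IHm] k /=.
  by rewrite addn0 => -> _; rewrite paths_above_all.
move=> def_r k_gt0; rewrite eqV; last by lia.
by apply: phi_add_paths; [lia | apply: IHm; lia].
Qed.

End UndoPaths.

(** * Vertex labels and LR hives *)

Lemma sum_from1_recr (f : nat -> int) m :
  \sum_(1 <= k < m.+2) f k = \sum_(1 <= k < m.+1) f k + f m.+1.
Proof. exact: big_nat_recr. Qed.

Lemma sum_diff n (f : nat -> int) :
  \sum_(1 <= k < n.+1) (f k - f k.-1) = f n - f 0%N.
Proof. by rewrite big_add1 -telescope_sumr. Qed.

Lemma vertex_le n (v : vertex n) : ((val v).1 <= (val v).2 <= n)%N.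
Proof. by rewrite (valP v) -ltnS ltn_ord. Qed.

Section VertexLabels.
Variable n : nat.
Implicit Types (H K : tri n) (E : elabels).

Lemma vlab_val H (v : vertex n) : vlab H (val v).1 (val v).2 = H v.
Proof. by rewrite /vlab !inord_val -surjective_pairing valK. Qed.

Lemma eq_vlab H K :
    (forall i j, (i <= j <= n)%N -> vlab H i j = vlab K i j) -> H = K.
Proof.
move=> eqHK; apply/ffunP=> v; rewrite -!vlab_val; apply: eqHK.
exact: vertex_le.
Qed.

Lemma vlab_of_edges E i j : (i <= j <= n)%N ->
  vlab (of_edges n E) i j
  = \sum_(1 <= k < j.+1) al E 0 k + \sum_(1 <= k < i.+1) be E k j.
Proof.
move=> /andP[leij lejn]; rewrite /vlab.
have in_i : (inord i : 'I_n.+1) = i :> nat by rewrite inordK // ltnS (leq_trans leij).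
have in_j : (inord j : 'I_n.+1) = j :> nat by rewrite inordK.
by rewrite insubT /= ?in_i ?in_j // => lt_ij; rewrite ffunE /= in_i in_j.
Qed.

Lemma of_edges_agree E F : agree n E F -> of_edges n E = of_edges n F.
Proof.
case=> alEF beEF; apply: eq_vlab => i j /andP[leij lejn].
rewrite !vlab_of_edges ?leij //; congr (_ + _); apply: eq_big_nat => k.
  by move=> /andP[k_gt0 ltkj]; rewrite alEF // k_gt0 -ltnS (leq_trans ltkj).
by move=> /andP[k_gt0 ltki]; rewrite beEF // k_gt0 -ltnS (leq_trans ltki).
Qed.

Lemma edgesK H : vlab H 0 0 = 0 -> of_edges n (edges H) = H.
Proof.
move=> H00; apply: eq_vlab => i j le_ij; rewrite vlab_of_edges //=.
by rewrite (sum_diff j (vlab H 0)) (sum_diff i (vlab H ^~ j)) H00; lia.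
Qed.

Lemma edges_of_edges E :
    (forall i j, (i < j < n)%N ->
       be E i.+1 j.+1 - be E i.+1 j = al E i.+1 j.+1 - al E i j.+1) ->
  agree n (edges (of_edges n E)) E.
Proof.
move=> triE; split=> [i [//|j] /andP[ltij lejn]|[//|i] j /= leij lejn] /=.
  rewrite !vlab_of_edges ?lejn ?(ltnW lejn) ?andbT //; last exact: ltnW.
  rewrite sum_from1_recr; elim: i ltij => [|i IHi] ltij.
    by rewrite !(@big_geq _ _ _ 1 1) // !addr0 addrAC subrr add0r.
  have := IHi (ltnW ltij); have := triE i j; rewrite lejn -ltnS ltij => /(_ isT).
  by rewrite !(sum_from1_recr _ i); lia.
rewrite !vlab_of_edges ?lejn ?andbT //; last exact: ltnW.
by rewrite sum_from1_recr; lia.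
Qed.

End VertexLabels.

Lemma theta_addK n (K : tri n) r E F : (0 < r)%N -> lr_array r E ->
    `|(be (edges K) r n - \sum_(r.+1 <= m < n.+1) Ug (edges K) r m)%R|%N
      = nomega r E ->
    `|al (edges K) 0 r|%N = nchi r E ->
    (forall k, (0 < k < r)%N -> `|Ug (edges K) k r|%N = nterm r E k) ->
    agree r F (theta r E) ->
  agree r (theta_add K r F) E.
Proof.
move=> r_gt0 lrE eq_omega eq_chi eq_phi agF; rewrite /theta_add eq_omega eq_chi.
apply: agree_iter; first exact: chi_addK.
apply: phi_add_all => //; apply: agree_iter agF; exact: omega_addK.
Qed.

Lemma lr_al_nonneg r E i j : lr_array r E -> (i < j <= r)%N -> 0 <= al E i j.
Proof.
move=> lrE /andP[ltij lejr].
apply: le_trans (@lr_al_mono r E 0 i j lrE ltij lejr).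
have: (0 < j)%N by exact: leq_ltn_trans ltij.
rewrite -(subKn lejr); elim: (r - j)%N => [|m IHm] j_gt0.
  by rewrite subn0 in j_gt0 *; apply: lr_al_ge0.
have eqj : (r - m = (r - m.+1).+1)%N by lia.
rewrite eqj in IHm; apply: le_trans (IHm isT) _.
have lt_j : (0 < r - m.+1 < r)%N by lia.
exact: le_trans (lr_upright lrE lt_j) (lr_right lrE lt_j).
Qed.

Lemma lr_be_nonneg r E i j : lr_array r E -> (0 < i <= j)%N -> (j <= r)%N ->
  0 <= be E i j.
Proof.
move=> lrE /andP[i_gt0 leij] lejr.
have: 0 <= be E i i.
  have leir := leq_trans leij lejr; move: i_gt0; rewrite -(subKn leir).
  elim: (r - i)%N => [|m IHm] m_gt0; first by rewrite subn0 in m_gt0 *; apply: lr_be_ge0.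
  have eqj : (r - m = (r - m.+1).+1)%N by lia.
  rewrite eqj in IHm; apply: le_trans (IHm isT) _.
  have lt_j : ((r - m.+1).-1 < r - m.+1 < r)%N by lia.
  by have := lr_left lrE lt_j; rewrite prednK.
move=> /le_trans; apply; move: lejr; rewrite -(subnKC leij).
elim: (j - i)%N => [|m IHm] lemr; first by rewrite addn0.
rewrite addnS in lemr *; apply: le_trans (IHm (ltnW lemr)) _.
have lt_i : (i.-1 < i + m < r)%N by lia.
have := lr_triangle lrE lt_i; have := lr_upright lrE lt_i; rewrite prednK //.
by lia.
Qed.

(** The triangle conditions hold for the edges of any vertex labelling, and the
nonnegativity of all edges is carried from the corners by the gradients. *)
Lemma LR_hiveP n (H : tri n) :
  is_LR_hive H <-> vlab H 0 0 = 0 /\ lr_array n (edges H).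
Proof.
split=> [[[H00 grad] al_ge0 be_ge0]|[H00 lrH]].
  have gradS i j : (i < j < n)%N ->
      [/\ 0 <= Rg (edges H) i.+1 j.+1, 0 <= Ug (edges H) i.+1 j.+1
        & 0 <= Lg (edges H) i.+1 j.+1] by case/andP=> ltij ltjn; apply: grad.
  split=> //; split=> [i j ltij|i j ltij|i j ltij|i j ltij|n_gt0|n_gt0|j ltjn].
  - by rewrite /=; lia.
  - by have [_ + _] := gradS i j ltij; rewrite subr_ge0.
  - by have [+ _ _] := gradS i j ltij; rewrite subr_ge0.
  - by have [_ _ +] := gradS i j ltij; rewrite subr_ge0.
  - by apply: al_ge0; rewrite n_gt0 leqnn.
  - by have [] := be_ge0 n n; rewrite ?n_gt0 ?leqnn.
  - by rewrite /=; lia.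
split=> [|i j|i j lt_ij lejn].
- split=> // [[|i]] [|j] // ltij lejn; have lt_ij : (i < j < n)%N by apply/andP.
  rewrite !subr_ge0; split.
  + exact: (lr_right lrH).
  + exact: (lr_upright lrH).
  + exact: (lr_left lrH).
- exact: lr_al_nonneg.
have be_ge0 := lr_be_nonneg lrH lt_ij lejn; split=> //.
case: i lt_ij be_ge0 => // i lt_ij be_ge0.
have: 0 <= al (edges H) i j by apply: (lr_al_nonneg lrH); rewrite lejn andbT.
by move: be_ge0 => /=; lia.
Qed.

Definition boundary n (f : nat -> int) : seq nat := [seq `|f k|%N | k <- iota 1 n].

Section Boundary.
Variables (n : nat) (f : nat -> int).
Hypothesis f_ge0 : forall k, (0 < k <= n)%N -> 0 <= f k.

Lemma part_boundary k : (0 < k <= n)%N -> (part (boundary n f) k)%:Z = f k.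
Proof.
case: k => // k /= ltkn; rewrite /part /boundary (nth_map 0%N) ?size_iota //.
by rewrite nth_iota // add1n /=; have := f_ge0 (k := k.+1) ltkn; lia.
Qed.

Lemma part_boundary_out k : (n < k)%N -> part (boundary n f) k = 0%N.
Proof. by move=> ltnk; rewrite /part nth_default // size_map size_iota; lia. Qed.

Lemma boundary_is_part :
  (forall k, (0 < k < n)%N -> f k.+1 <= f k) -> is_part (boundary n f).
Proof.
move=> f_anti; apply/(sortedP 0%N) => i; rewrite size_map size_iota => ltin.
have := part_boundary (k := i.+1); have := part_boundary (k := i.+2).
have := f_anti i.+1; rewrite /part /= ltin ltnW // => /(_ isT).
by move=> le_f /(_ isT) + /(_ isT); lia.
Qed.

Lemma sumn_boundary : (sumn (boundary n f))%:Z = \sum_(1 <= k < n.+1) f k.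
Proof.
rewrite sumnE big_map /index_iota subSS subn0 (big_morph Posz PoszD (erefl _)).
apply: eq_big_seq => k; rewrite mem_iota add1n ltnS => /f_ge0; lia.
Qed.

Lemma plen_boundary : (plen (boundary n f) <= n)%N.
Proof. by rewrite (leq_trans (count_size _ _)) // size_map size_iota. Qed.

End Boundary.

(** The boundary of an LR hive determines the three partitions, and the required
relations between them are consequences of the rhombus inequalities. *)
Lemma all_LR_hivesP n (H : tri n) : all_LR_hives H <-> is_LR_hive H.
Proof.
split=> [[lam [mu [nu [_ _ _ _ []]]]] //|lrhH].
have [H00 lrH] := (LR_hiveP H).1 lrhH; have [_ _ be_ga_ge0] := lrhH.
pose lam k := ga (edges H) k k; pose mu k := al (edges H) 0 k.
pose nu k := be (edges H) k n.
have lam_ge0 k : (0 < k <= n)%N -> 0 <= lam k.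
  by case/andP=> k_gt0 lekn; have [] := be_ga_ge0 k k _ lekn; rewrite ?k_gt0 /=.
have mu_ge0 k : (0 < k <= n)%N -> 0 <= mu k by exact: lr_al_nonneg.
have nu_ge0 k : (0 < k <= n)%N -> 0 <= nu k.
  by case/andP=> k_gt0 lekn; apply: (lr_be_nonneg lrH) => //; rewrite k_gt0.
exists (boundary n lam), (boundary n mu), (boundary n nu); split.
- split; apply: boundary_is_part => // [] [|k] //= ltkn.
  + exact: (lr_lower_anti lrH).
  + have lt0k : (0 < k.+1 < n)%N by [].
    exact: le_trans (lr_upright lrH lt0k) (lr_right lrH lt0k).
  + have lt_k : (k < n.-1 < n)%N by lia.
    have lt_k' : (k.+1 < n.-1.+1)%N by lia.
    have := lr_left lrH lt_k; have := lr_triangle lrH lt_k.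
    have := lr_upright lrH lt_k; rewrite prednK ?(leq_trans _ ltkn) // /nu.
    by lia.
- exact: plen_boundary.
- have le_part (g h : nat -> int) : (forall k, (0 < k <= n)%N -> 0 <= g k) ->
      (forall k, (0 < k <= n)%N -> 0 <= h k) ->
      (forall k, (0 < k <= n)%N -> g k <= h k) -> pincl (boundary n g) (boundary n h).
    move=> g0 h0 gh k k_gt0; have [lekn|ltnk] := leqP k n; last first.
      by rewrite !part_boundary_out.
    have lk : (0 < k <= n)%N by rewrite k_gt0.
    by have := part_boundary g0 lk; have := part_boundary h0 lk; have := gh k lk; lia.
  split; apply: le_part => // [] [|k] //= ltkn.
  + have := @lr_al_mono n (edges H) 0 k k.+1 lrH; rewrite ltnSn => /(_ isT ltkn).
    have := lr_lower lrH ltkn.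
    have := lr_be_nonneg lrH (i := k.+1) (j := k.+1); rewrite leqnn => /(_ isT ltkn).
    rewrite /lam /mu; lia.
  + have : ga (edges H) k.+1 n <= lam k.+1.
      suff ga_le m : (k.+1 + m <= n)%N -> ga (edges H) k.+1 (k.+1 + m) <= lam k.+1.
        by have := ga_le (n - k.+1)%N; rewrite subnKC // => /(_ (leqnn n)).
      elim: m => [|m IHm]; rewrite ?addn0 // addnS => ltm.
      apply: le_trans (IHm (ltnW ltm)); have lt_k : (k < k.+1 + m < n)%N by lia.
      by have := lr_right lrH lt_k; rewrite /=; lia.
    have: 0 <= al (edges H) k n by apply: (lr_al_nonneg lrH); rewrite ltkn leqnn.
    by rewrite /lam /nu /=; lia.
- apply/eqP; rewrite -(eqr_nat int) !natz PoszD !sumn_boundary //; apply/eqP.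
  rewrite (sum_diff n (fun k => vlab H k k)) (sum_diff n (vlab H 0)).
  by rewrite (sum_diff n (vlab H ^~ n)) H00; lia.
by split=> // k lk; rewrite !part_boundary.
Qed.

(** * Injections of finite sets *)

(** The coding e replaces a finiteness proof for S: two points of the f-orbit of
y have the same code, hence coincide, and cancelling f shows that y recurs. *)
Lemma surj_of_inj_bounded (T : Type) (F : finType) (S : T -> Prop) (f : T -> T)
    (e : T -> F) :
    (forall x, S x -> S (f x)) ->
    (forall x y, S x -> S y -> f x = f y -> x = y) ->
    (forall x y, S x -> S y -> e x = e y -> x = y) ->
  forall y, S y -> exists2 x, S x & f x = y.
Proof.
move=> stab_f inj_f inj_e y Sy.
have S_iter k x : S x -> S (iter k f x) by move=> Sx; elim: k => // k /stab_f.
pose orb (k : 'I_#|F|.+1) := e (iter k f y).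
have /injectivePn[i [j neq_ij eq_ij]] : ~~ injectiveb orb.
  by apply/injectiveP => /leq_card; rewrite card_ord ltnn.
have {eq_ij} eq_ij : iter i f y = iter j f y by apply: inj_e => //; apply: S_iter.
wlog lt_ij : i j neq_ij eq_ij / (i < j)%N => [th|].
  case: (ltngtP i j) => [|lt|/ord_inj eq]; first exact: th.
    by apply: (th j i) => //; rewrite eq_sym.
  by case/eqP: neq_ij.
have [d def_d] : exists d, (d.+1 + i = j)%N by exists (j - i.+1)%N; lia.
rewrite -def_d iterD in eq_ij; exists (iter d f y); first exact: S_iter.
have comm k l : iter k f (iter l f y) = iter l f (iter k f y).
  by rewrite -!iterD addnC.
have Sz : S (iter d.+1 f y) by apply: S_iter.
rewrite comm in eq_ij; rewrite -iterS; move: (iter d.+1 f y) Sz eq_ij => z Sz.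
elim: (nat_of_ord i) => [/= -> |k IHk] //.
rewrite !iterS => /inj_f eq_k.
by apply: IHk; apply: eq_k; apply: S_iter.
Qed.

(** * The map sigma *)

Section Sigma.
Variables (n : nat) (H : tri n).
Hypotheses (H00 : vlab H 0 0 = 0) (lrH : lr_array n (edges H)).

(** The hive of side r in the chain of truncations of H. *)
Definition truncation r := rem_chain H (n - r).
Let Hr := truncation.
Let V := Vrem H.

Lemma truncation_full : Hr n = edges H.
Proof. by rewrite /Hr /truncation subnn. Qed.

Lemma truncationS r : (r < n)%N -> Hr r = kappa r.+1 (theta r.+1 (Hr r.+1)).
Proof.
move=> ltrn; rewrite /Hr /truncation.
have -> : (n - r = (n - r.+1).+1)%N by lia.
by rewrite /= subKn.
Qed.

Lemma truncation_ind (P : nat -> Prop) :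
  P n -> (forall r, (r < n)%N -> P r.+1 -> P r) -> forall r, (r <= n)%N -> P r.
Proof.
move=> Pn PS r lern; rewrite -(subKn lern); elim: (n - r)%N => [|m IHm].
  by rewrite subn0.
have [ltmn|lenm] := ltnP m n; last by have -> : (n - m.+1 = n - m)%N by lia.
by apply: PS; [lia | have -> : ((n - m.+1).+1 = n - m)%N by lia].
Qed.

Lemma lr_truncation r : (r <= n)%N -> lr_array r (Hr r).
Proof.
move: r; apply: truncation_ind => [|r ltrn lr_r]; first by rewrite truncation_full.
by rewrite truncationS //; apply: lr_theta (ltn0Sn r) lr_r.
Qed.

(** Apart from [chi] no step changes the numbers of positive letters, and the letters x
with x < r all lie in the first r - 1 rows once row r is empty. *)
Lemma be_truncation x r : (0 < x <= r)%N -> (r <= n)%N ->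
  be (Hr r) x r = be (edges H) x n.
Proof.
move=> + lern; move: r lern; apply: truncation_ind => [|r ltrn IHr lexr].
  by rewrite truncation_full.
have {IHr} <- := IHr ltac:(lia); rewrite truncationS //= ltnSn.
case: x lexr => // x /= ltxr.
rewrite -(@be_theta_right r.+1 (Hr r.+1) x.+1) // (be_theta_stay (ltn0Sn r)) //.
exact: lr_truncation.
Qed.

Lemma Vrem_passes k r : (k < r <= n)%N ->
  (V k r + passes r (Hr r) 0 k)%N = passes r (Hr r) 0 k.+1.
Proof. by move=> /andP[ltkr lern]; apply: nterm_passes ltkr. Qed.

Lemma sum_Vrem_passes i j : (i < j <= n)%N ->
  (\sum_(1 <= k < i.+1) V k j)%N = passes j (Hr j) 0 i.+1.
Proof.
move=> /andP[ltij lejn]; elim: i ltij => [|i IHi] ltij.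
  by rewrite big_geq // passes_out //; lia.
by rewrite big_nat_recr //= IHi 1?ltnW // addnC Vrem_passes // ltij.
Qed.

Lemma al_truncationS k r : (0 < k <= r)%N -> (r < n)%N ->
  al (Hr r) 0 k = al (Hr r.+1) 0 k - (V k r.+1)%:Z.
Proof.
move=> /andP[k_gt0 lekr] ltrn; rewrite truncationS //= ltnS lekr al_theta //.
by have := @Vrem_passes k r.+1; rewrite ltnS lekr ltrn => /(_ isT); lia.
Qed.

Lemma al_truncation k r : (0 < k <= r)%N -> (r <= n)%N ->
  al (Hr r) 0 k = al (edges H) 0 k - (\sum_(r.+1 <= m < n.+1) V k m)%N%:Z.
Proof.
move=> + lern; move: r lern; apply: truncation_ind => [|r ltrn IHr /andP[k0 lekr]].
  by rewrite truncation_full big_geq // subr0.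
rewrite al_truncationS ?k0 // IHr; last by rewrite k0 leqW.
by rewrite [in RHS]big_ltn 1?ltnS //; lia.
Qed.

Let K := sigma_edges H.

Lemma al_sigma_edges i j : (i < j <= n)%N ->
  al K i j = be (edges H) j n + (passes j (Hr j) 0 i.+1)%:Z.
Proof. by move=> lt_ij; rewrite -sum_Vrem_passes. Qed.

Lemma be_sigma_edges i j : (0 < i <= j)%N -> (j <= n)%N ->
  be K i j = al (Hr j) 0 i.
Proof. by move=> le_ij lejn; rewrite al_truncation. Qed.

Lemma Ug_sigma_edges k j : Ug K k.+1 j = (V k.+1 j)%:Z.
Proof.
rewrite /Ug /=.
have -> : (\sum_(1 <= l < k.+2) V l j = \sum_(1 <= l < k.+1) V l j + V k.+1 j)%N.
  exact: big_nat_recr.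
by rewrite /V PoszD; lia.
Qed.

Lemma sigma_edges_triangle i j : (i < j < n)%N ->
  be K i.+1 j.+1 - be K i.+1 j = al K i.+1 j.+1 - al K i j.+1.
Proof.
move=> /andP[ltij ltjn]; rewrite !be_sigma_edges ?(ltnW ltjn) //; last by lia.
have := Ug_sigma_edges i j.+1; rewrite /Ug => ->.
by rewrite (@al_truncationS i.+1 j) //; lia.
Qed.

(** The labels of [sigma H] are those of the truncations: [be] is the number of
letters 0, and [al] counts the [chi]-paths and the [phi]-paths that leave row
i+1. *)
Lemma lr_sigma_edges : lr_array n K.
Proof.
split=> [i j|i j lt_ij|i j /andP[ltij ltjn]|i j /andP[ltij ltjn]|n_gt0|n_gt0|j ltjn].
- exact: sigma_edges_triangle.
- by rewrite -subr_ge0; have := Ug_sigma_edges i j.+1; rewrite /Ug => ->.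
- rewrite !al_sigma_edges ?ltnS ?ltij ?(ltnW ltjn) //.
  have j_gt0 : (0 < j)%N by exact: leq_ltn_trans ltij.
  have := passes_shift j_gt0 (lr_truncation ltjn) (x := 0) (d := i.+1).
  rewrite ltij -truncationS // => /(_ isT).
  by rewrite !be_truncation ?j_gt0 ?leqnn // ltnW.
- rewrite !be_sigma_edges ?(ltnW ltjn) //.
  have lt_i : (0 < i.+1 < j.+1)%N by [].
  have := inner_interlace (ltn0Sn j) (lr_truncation ltjn) lt_i.
  by rewrite [Hr j]truncationS //= ltnS ltij.
- rewrite al_sigma_edges ?n_gt0 ?leqnn //.
  by have := lr_be_ge0 lrH n_gt0; lia.
- rewrite be_sigma_edges ?n_gt0 ?leqnn // truncation_full.
  by apply: (lr_al_nonneg lrH); rewrite n_gt0 leqnn.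
- by [].
Qed.

Lemma edges_sigma : agree n (edges (sigma H)) K.
Proof. exact/edges_of_edges/sigma_edges_triangle. Qed.

Lemma vlab_sigma00 : vlab (sigma H) 0 0 = 0.
Proof. by rewrite vlab_of_edges // !big_geq. Qed.

Lemma lr_agree_edges (G : tri n) E : agree n (edges G) E -> lr_array n E ->
  lr_array n (edges G).
Proof.
case=> alG beG [tE uE rE lE a0 b0 _].
split=> [i j lt_ij|i j lt_ij|i j lt_ij|i j lt_ij|n_gt0|n_gt0|j ltjn].
- by rewrite !alG ?beG; try lia; apply: tE.
- by rewrite !alG; try lia; apply: uE.
- by rewrite !alG; try lia; apply: rE.
- by rewrite !beG; try lia; apply: lE.
- by rewrite alG ?n_gt0 ?leqnn //; apply: a0.
- by rewrite beG ?n_gt0 ?leqnn //; apply: b0.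
by rewrite /=; lia.
Qed.

Lemma lr_hive_sigma : is_LR_hive (sigma H).
Proof.
apply/LR_hiveP; split; first exact: vlab_sigma00.
exact: lr_agree_edges edges_sigma lr_sigma_edges.
Qed.

Lemma vlab_last_sigma : vlab (sigma H) n n = vlab H n n.
Proof.
have {2}<- := edgesK H00; rewrite !vlab_of_edges ?leqnn //= addrC.
congr (_ + _); apply: eq_big_nat => k _; rewrite big_geq //; lia.
Qed.

(** Rebuilding from the gradients of [sigma H] runs through the truncations of H
in reverse. *)
Lemma add_chain_sigma r : (r <= n)%N -> agree r (add_chain (sigma H) r) (Hr r).
Proof.
have [alK beK] := edges_sigma.
elim: r => [|r IHr] ltrn; first by split=> i j; lia.
have lrHr := lr_truncation ltrn; rewrite /=.
have UgK k m : (0 < k < m)%N -> (m <= n)%N -> Ug (edges (sigma H)) k m = (V k m)%:Z.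
  case: k => // k ltkm lemn; rewrite -Ug_sigma_edges /Ug.
  by congr (_ - _); apply: alK; lia.
have [chiE _ omegaE] := lr_exponents lrHr (ltn0Sn r).
apply: theta_addK => //.
- rewrite omegaE beK ?ltnS ?leqnn //; congr absz.
  rewrite (eq_big_nat _ _ (F2 := fun m => (V r.+1 m)%:Z)).
    rewrite be_sigma_edges // al_truncation ?leqnn //.
    rewrite big_geq // subr0 al_truncation ?leqnn //.
    by rewrite (big_morph Posz PoszD (erefl _)).
  by move=> m /andP[ltrm lemn]; apply: UgK.
- rewrite chiE alK // al_sigma_edges // passes_out // addr0.
  by rewrite be_truncation ?leqnn.
- by move=> k /andP[k_gt0 ltkr]; rewrite UgK ?k_gt0 // /V /Vrem.
- apply: kappa_invK => //.
  by rewrite /= -truncationS //; apply: IHr; apply: ltnW.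
Qed.

Lemma sigmaK : sigma_add (sigma H) = H.
Proof.
rewrite /sigma_add -[RHS](edgesK H00); apply: of_edges_agree.
by rewrite -truncation_full; apply: add_chain_sigma.
Qed.

End Sigma.

Lemma vlab_bounds n (H : tri n) i j : is_LR_hive H -> (i <= j <= n)%N ->
  0 <= vlab H i j <= vlab H n n.
Proof.
move=> /LR_hiveP[H00 lrH] /andP[leij lejn].
have al_ge0 a b : (a < b <= n)%N -> vlab H a b.-1 <= vlab H a b.
  by move=> lt_ab; have := lr_al_nonneg lrH lt_ab; rewrite subr_ge0.
have be_ge0 a b : (0 < a <= b)%N -> (b <= n)%N -> vlab H a.-1 b <= vlab H a b.
  by move=> le_ab lebn; have := lr_be_nonneg lrH le_ab lebn; rewrite subr_ge0.
have row a b c : (a <= b <= c)%N -> (c <= n)%N -> vlab H a b <= vlab H a c.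
  move=> /andP[leab /subnKC <-]; elim: (c - b)%N => [|m IHm].
    by rewrite addn0.
  rewrite addnS => lem.
  by apply: le_trans (IHm (ltnW lem)) (al_ge0 _ (_).+1 _); lia.
have col a b c : (a <= b <= c)%N -> (c <= n)%N -> vlab H a c <= vlab H b c.
  move=> /andP[/subnKC <-]; elim: (b - a)%N => [|m IHm].
    by rewrite addn0.
  rewrite addnS => lem lecn.
  by apply: le_trans (IHm (ltnW lem) lecn) (be_ge0 (_).+1 _ _ lecn); lia.
apply/andP; split.
  by rewrite -H00; apply: le_trans (row 0%N 0%N j _ lejn) (col 0%N i j _ lejn); lia.
by apply: le_trans (row i j n _ _) (col i n n _ _); lia.
Qed.

Lemma inord_absz_inj N (a b : int) : 0 <= a <= N%:Z -> 0 <= b <= N%:Z ->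
  (inord `|a|%N : 'I_N.+1) = inord `|b|%N -> a = b.
Proof. by move=> a_in b_in /(congr1 val) /=; rewrite !inordK; lia. Qed.

(** LR hives with a given last label have all their labels between 0 and that
label, so that [surj_of_inj_bounded] applies to them. *)
Lemma sigma_surj n (K : tri n) : is_LR_hive K ->
  exists2 H : tri n, is_LR_hive H & sigma H = K.
Proof.
move=> lrK; pose N := `|vlab K n n|%N.
pose S (H : tri n) := is_LR_hive H /\ vlab H n n = N%:Z.
have SP H : S H -> vlab H 0 0 = 0 /\ lr_array n (edges H) by case=> /LR_hiveP.
pose code (H : tri n) : {ffun vertex n -> 'I_N.+1} :=
  [ffun v => inord `|H v|%N].
have [||||H [lrH _] <-] := @surj_of_inj_bounded (tri n) _ S (@sigma n) code _ _ _ K;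
  last by exists H.
- move=> H SH; have [H00 lrH] := SP H SH; split; first exact: lr_hive_sigma.
  by rewrite vlab_last_sigma //; case: SH.
- move=> H G /SP[H00 lrH] /SP[G00 lrG] eqHG.
  by rewrite -(sigmaK H00 lrH) eqHG sigmaK.
- move=> H G [lrH HN] [lrG GN] /ffunP eq_code; apply/ffunP => v.
  have := eq_code v; rewrite !ffunE; apply: inord_absz_inj.
    by rewrite -HN -(vlab_val H); apply: vlab_bounds (vertex_le v).
  by rewrite -GN -(vlab_val G); apply: vlab_bounds (vertex_le v).
- split=> //; have [K00 lrK'] := (LR_hiveP K).1 lrK.
  have := vlab_bounds lrK (i := n) (j := n); rewrite leqnn => /(_ isT).
  by rewrite /N; lia.
Qed.

Theorem theorem10p2 (n : nat) (hn : (0 < n)%N) :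
  (forall H : tri n, all_LR_hives H -> all_LR_hives (sigma H)) /\
  (forall K : tri n, all_LR_hives K -> all_LR_hives (sigma_add K)) /\
  (forall H : tri n, all_LR_hives H -> sigma_add (sigma H) = H) /\
  (forall K : tri n, all_LR_hives K -> sigma (sigma_add K) = K).
Proof.
have sigK (H : tri n) : is_LR_hive H -> sigma_add (sigma H) = H.
  by case/LR_hiveP; apply: sigmaK.
split=> [H /all_LR_hivesP/LR_hiveP[H00 lrH]|].
  exact/all_LR_hivesP/lr_hive_sigma.
split=> [K /all_LR_hivesP/sigma_surj[H lrH <-]|].
  by rewrite sigK //; apply/all_LR_hivesP.
split=> [H /all_LR_hivesP|K /all_LR_hivesP/sigma_surj[H lrH <-]]; first exact: sigK.
by rewrite sigK.
Qed.
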